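(* Let $E\subset\mathbb{C}^N$ be a nonpluripolar compact set with an admissible weight function $w$, and let $$F=F(E,w):=\{(t,z)=(t,t\lambda)\in\mathbb{C}^{N+1}:\lambda\in E,\ |t|=w(\lambda)\}.$$ Then $$\delta^w(E)=d^{(H)}(F)^{\frac{N+1}{N}}=d(F)^{\frac{N+1}{N}},$$ where $d^{(H)}(F)$ and $d(F)$ are the homogeneous transfinite diameter and the transfinite diameter of $F$ in $\mathbb{C}^{N+1}$.
   Context: For $n\ge1$ let $e_1,e_2,\dots$ be a listing of the monomials $e_i(z)=z^{\alpha(i)}$ in $\mathbb{C}^n$, using a lexicographic ordering on the multiindices but with degrees $|\alpha(i)|$ nondecreasing (in $\mathbb{C}^{N+1}$ with coordinates $(t,z_1,\dots,z_N)$, $t$ precedes $z_1,\dots,z_N$). Let $m_d^{(n)}=\binom{n+d}{d}$ be the number of monomials of degree at most $d$ in $n$ variables, $h_d^{(n)}=\binom{n-1+d}{d}$ the number of degree exactly $d$, and $l_d^{(n)}=n\binom{n+d}{n+1}$ the sum of the degrees of the $m_d^{(n)}$ monomials of degree at most $d$. Let $VDM(\zeta_1,\dots,\zeta_m)=\det[e_i(\zeta_j)]_{i,j=1,\dots,m}$, and, writing $e^{(H,d)}_i$, $i=1,\dots,h_d^{(n)}$, for the monomials of degree exactly $d$, let $VDMH_d(\zeta_1,\dots,\zeta_{h_d^{(n)}})=\det[e^{(H,d)}_i(\zeta_j)]_{i,j=1,\dots,h_d^{(n)}}$. For a bounded set $K\subset\mathbb{C}^n$ define $$d(K)=\lim_{d\to\infty}\Bigl[\sup_{\zeta_j\in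 K}|VDM(\zeta_1,\dots,\zeta_{m_d^{(n)}})|\Bigr]^{1/l_d^{(n)}},\qquad d^{(H)}(K)=\lim_{d\to\infty}\Bigl[\sup_{\zeta_j\in K}|VDMH_d(\zeta_1,\dots,\zeta_{h_d^{(n)}})|\Bigr]^{1/(d\,h_d^{(n)})}$$ (the limits exist). An admissible weight function on $E$ is a nonnegative upper semicontinuous function $w$ on $E$ with $\{z\in E:w(z)>0\}$ nonpluripolar. The weighted transfinite diameter is $$\delta^w(E):=\lim_{d\to\infty}\Bigl[\max_{\lambda^{(i)}\in E}|VDM(\lambda^{(1)},\dots,\lambda^{(m_d^{(N)})})|\,w(\lambda^{(1)})^d\cdots w(\lambda^{(m_d^{(N)})})^d\Bigr]^{1/l_d^{(N)}}$$ (the limit exists). *)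

(* Defs.v *)
From HB Require Import structures.
From mathcomp Require Import all_boot all_order all_algebra.
From mathcomp Require Import all_classical all_reals all_analysis.
From mathcomp Require Import complex.

Set Implicit Arguments.
Unset Strict Implicit.
Unset Printing Implicit Defensive.

Import Order.TTheory GRing.Theory Num.Theory.
Import numFieldNormedType.Exports.

Local Open Scope classical_set_scope.
Local Open Scope ring_scope.
Local Open Scope complex_scope.

(* The library only puts the topology of the norm on the alias R[i]^o. *)
HB.instance Definition _ (R : realType) := PseudoMetric.copy R[i] R[i]^o.

(** * Monomials *)

(* A multi-index in n variables is a list of n naturals.  Within one degree the
   order is lexicographic with the first coordinate preceding the others, so
   that x_1^k comes first and x_n^k last. *)
Fixpoint hmonos (n k : nat) : seq (seq nat) :=
  if n is n'.+1 then
    flatten [seq [seq i :: a | a <- hmonos n' (k - i)] | i <- rev (iota 0 k.+1)]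
  else if k is 0 then [:: [::]] else [::].

Definition monos (n d : nat) : seq (seq nat) :=
  flatten [seq hmonos n k | k <- iota 0 d.+1].

(* The listing is 0-based, and for 0 < n there are more than i monomials of
   degree at most i, so monos n i is long enough (see nth_monos below). *)
Definition mono_idx (n i : nat) : seq nat := nth [::] (monos n i) i.

Definition hmono_idx (n d i : nat) : seq nat := nth [::] (hmonos n d) i.

Definition monomial (R : realType) (n : nat) (a : seq nat) (z : 'rV[R[i]]_n) :
    R[i] :=
  \prod_(k < n) z ord0 k ^+ nth 0%N a k.

Definition mdim (n d : nat) : nat := 'C(n + d, d).
Definition hdim (n d : nat) : nat := 'C(n.-1 + d, d).
Definition ldeg (n d : nat) : nat := (n * 'C(n + d, n.+1))%N.

Lemma hmonosS n k : hmonos n.+1 k =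
  flatten [seq [seq i :: a | a <- hmonos n (k - i)] | i <- rev (iota 0 k.+1)].
Proof. by []. Qed.

Lemma mem_hmonos n k a : (a \in hmonos n k) = (size a == n) && (sumn a == k).
Proof.
elim: n k a => [|n IH] k a.
  by case: k a => [|k] [|x a]; rewrite ?inE //= andbF.
rewrite hmonosS; apply/flatten_mapP/andP => [[i +] | [ ]].
  rewrite mem_rev mem_iota add0n ltnS => ik /mapP[b].
  rewrite IH => /andP[/eqP sb /eqP sumb] ->.
  by rewrite /= sb eqxx sumb addnC subnK.
case: a => [//|x a] sa /eqP xa; exists x.
  by rewrite mem_rev mem_iota add0n ltnS -xa /= leq_addr.
by apply: map_f; rewrite IH -eqSS sa -xa addKn /= eqxx.
Qed.

Lemma pairwise_hmonos n k :
  pairwise (fun a b : seqlexi nat => (b < a)%O) (hmonos n k).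
Proof.
elim: n k => [|n IH] k; first by case: k.
rewrite hmonosS.
have : pairwise (fun x y => y < x)%N (rev (iota 0 k.+1)).
  by rewrite -sorted_pairwise ?rev_sorted ?iota_ltn_sorted // => x y z yx zy;
    apply: ltn_trans zy yx.
elim: (rev _) => [//|i s IHs] /andP[/allP is_ ps] /=.
rewrite pairwise_cat IHs // andbT; apply/andP; split.
  apply/allrelP => _ b /mapP[a _ ->] /flatten_mapP[j /is_ ji /mapP[c _ ->]].
  by rewrite ltxi_cons !leEnat (ltnW ji) leqNgt ji.
rewrite pairwise_map; apply: sub_pairwise (IH _) => a b ba /=.
by rewrite ltxi_cons lexx.
Qed.

Lemma sum_bin n d : (\sum_(k < d.+1) 'C(n + k, k) = 'C(n.+1 + d, d))%N.
Proof.
elim: d => [|d IH]; first by rewrite big_ord1 !bin0.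
by rewrite big_ord_recr /= IH addSnnS [in RHS]addSn binS addnC.
Qed.

Lemma size_hmonos n k : (0 < n)%N -> size (hmonos n k) = hdim n k.
Proof.
rewrite /hdim; elim: n k => // n IH k _.
rewrite hmonosS size_flatten /shape -map_comp sumnE big_map.
rewrite (perm_big (iota 0 k.+1)) ?perm_rev //.
rewrite -[iota 0 k.+1]/(index_iota 0 k.+1) big_mkord.
under eq_bigr do rewrite /= size_map.
rewrite (reindex_inj rev_ord_inj) /=.
under eq_bigr => i _ do rewrite subSS subKn -1?ltnS //.
case: n IH => [|n] IH; last first.
  by under eq_bigr do rewrite IH //=; rewrite sum_bin.
rewrite big_ord_recl big1 //= add0n binn //.
Qed.

Lemma size_monos n d : size (monos n d) = mdim n d.
Proof.
rewrite /monos /mdim size_flatten /shape -map_comp sumnE big_map.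
rewrite -[iota 0 d.+1]/(index_iota 0 d.+1) big_mkord /=.
case: n => [|n]; first by rewrite big_ord_recl big1 //= add0n binn.
by under eq_bigr do rewrite size_hmonos // /hdim /=; rewrite sum_bin.
Qed.

Lemma nth_monos n d i : (0 < n)%N -> (i < mdim n d)%N ->
  nth [::] (monos n d) i = mono_idx n i.
Proof.
have stable d1 d2 : (d1 <= d2)%N -> (i < mdim n d1)%N ->
    nth [::] (monos n d2) i = nth [::] (monos n d1) i.
  move=> d12 id1; rewrite /monos -(subnKC d12) -addSn iotaD map_cat.
  by rewrite flatten_cat nth_cat -/(monos n d1) size_monos id1.
move=> n0 id; have ii : (i < mdim n i)%N.
  case: n n0 {stable id} => // n _; rewrite /mdim -sum_bin.
  rewrite -[leqLHS]card_ord -sum1_card leq_sum // => k _.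
  by rewrite bin_gt0 leq_addl.
by rewrite /mono_idx; have [/stable->|/ltnW/stable->] := leqP i d.
Qed.

Lemma ldegE n d : (0 < n)%N -> ldeg n d = (\sum_(k < d.+1) k * hdim n k)%N.
Proof.
case: n => // n _; rewrite /ldeg /hdim /=; elim: d => [|d IH].
  by rewrite big_ord1 mul0n addn0 bin_small ?muln0.
rewrite big_ord_recr /= -IH addnS binS mulnDr; congr addn.
rewrite [RHS]mul_bin_left -addSnnS addnK; congr muln.
by rewrite -bin_sub ?leq_addr // addKn.
Qed.

(** * Vandermonde determinants and transfinite diameters *)

Section TransfiniteDiameter.
Context {R : realType}.
Local Notation C := R[i].

Definition VDM (n m : nat) (zeta : 'I_m -> 'rV[C]_n) : C :=
  \det (\matrix_(i < m, j < m) monomial (mono_idx n i) (zeta j)).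

Definition VDMH (n d : nat) (zeta : 'I_(hdim n d) -> 'rV[C]_n) : C :=
  \det (\matrix_(i < hdim n d, j < hdim n d)
          monomial (hmono_idx n d i) (zeta j)).

Definition cabs (z : C) : R := complex.Re `|z|.

Definition sup_tuples (n m : nat) (K : set 'rV[C]_n)
    (f : ('I_m -> 'rV[C]_n) -> R) : R :=
  sup [set f zeta | zeta in [set zeta | forall j, K (zeta j)]].

(* Meaningful for bounded K only, since sup is 0 on unbounded sets of reals. *)
Definition transfinite_diameter (n : nat) (K : set 'rV[C]_n) : R :=
  limn (fun d : nat =>
    sup_tuples K (fun zeta : 'I_(mdim n d) -> 'rV[C]_n => cabs (VDM zeta))
      `^ (ldeg n d)%:R^-1).

Definition homogeneous_transfinite_diameter (n : nat) (K : set 'rV[C]_n) : R :=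
  limn (fun d : nat =>
    sup_tuples K (fun zeta : 'I_(hdim n d) -> 'rV[C]_n => cabs (VDMH zeta))
      `^ (d * hdim n d)%:R^-1).

Definition weighted_transfinite_diameter (n : nat) (E : set 'rV[C]_n)
    (w : 'rV[C]_n -> R) : R :=
  limn (fun d : nat =>
    sup_tuples E (fun lambda : 'I_(mdim n d) -> 'rV[C]_n =>
        cabs (VDM lambda) * \prod_(j < mdim n d) w (lambda j) ^+ d)
      `^ (ldeg n d)%:R^-1).

End TransfiniteDiameter.

(** * Pluripolar sets and admissible weights *)

Definition usc_on {R : realType} {T : topologicalType} (A : set T)
    (f : T -> \bar R) : Prop :=
  forall x (a : R), A x -> (f x < a%:E)%E ->
    \forall y \near within A (nbhs x), (f y < a%:E)%E.

Section Pluripolar.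
Context {R : realType}.
Local Notation C := R[i].

(* The function identically -oo is allowed here.  The integral is well defined:
   v is bounded above on the circle, so only its negative part may be +oo. *)
Definition subharmonic (v : C -> \bar R) : Prop :=
  [/\ forall z, (v z < +oo)%E,
      usc_on setT v &
      forall (c : C) (r : R), 0 < r ->
        (v c <= ((2 * pi)^-1)%:E *
           \int[lebesgue_measure]_(theta in `[0%R, (2 * pi)%R])
              v (c + r%:C * (cos theta +i* sin theta))%R)%E].

Definition plurisubharmonic (n : nat) (u : 'rV[C]_n -> \bar R) : Prop :=
  usc_on setT u /\
  forall a b : 'rV[C]_n, subharmonic (fun tau : C => u (a + tau *: b)).

Definition pluripolar (n : nat) (A : set 'rV[C]_n) : Prop :=
  exists u : 'rV[C]_n -> \bar R,
    [/\ plurisubharmonic u, exists z, u z != -oo%E &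
        A `<=` [set z | u z = -oo%E]].

(* w is a function on E: its values outside E play no role. *)
Definition admissible_weight (n : nat) (E : set 'rV[C]_n)
    (w : 'rV[C]_n -> R) : Prop :=
  [/\ forall z, E z -> 0 <= w z,
      usc_on E (EFin \o w) &
      ~ pluripolar [set z | E z /\ 0 < w z]].

(* The coordinates of C^(1 + n) are (t, z_1, ..., z_n). *)
Definition circled_set (n : nat) (E : set 'rV[C]_n) (w : 'rV[C]_n -> R) :
    set 'rV[C]_(1 + n) :=
  [set x | exists (t : C) (lambda : 'rV[C]_n),
     [/\ E lambda, cabs t = w lambda & x = row_mx t%:M (t *: lambda)]].

End Pluripolar.

(* Main.v *)
(* Write F for the set F(E,w).  On F the homogeneous Vandermonde determinant of
   degree d factors as prod_j t_j^d times VDM in C^N, so the weighted sequence is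
   the homogeneous one raised to the power (N+1)/N.

   Up to a factor m!, the maximal Vandermonde determinants on F are the products
   of the Chebyshev constants cheb a, the minimal sup norms over F of the
   polynomials z^a + (preceding monomials).  F is circled, so passing to the part
   of degree |a| does not increase the norm and the same homogeneous constants
   serve for both d(F) and d^(H)(F).  As cheb is submultiplicative, f = ln cheb
   is subadditive, and so is the average of f over the multi-indices of degree d:
   a Polya urn realises a uniform multi-index of degree d + e as a sum of uniform
   multi-indices of degrees d and e.  Fekete's lemma then yields the limit for
   d^(H)(F), and d(F) is the limit of a weighted Cesaro mean of the same averages.
   If some cheb a vanishes, all the determinants of large degree vanish. *)

Require Import Defs.
From mathcomp Require Import all_boot all_order all_algebra.
From mathcomp Require Import all_classical all_reals all_analysis.
From mathcomp Require Import perm cyclic separable cyclotomic complex.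
From mathcomp Require Import ring lra zify.
Import Order.TTheory GRing.Theory Num.Theory.
Import numFieldNormedType.Exports.
Local Open Scope classical_set_scope.
Local Open Scope ring_scope.

Set Implicit Arguments.
Unset Strict Implicit.
Unset Printing Implicit Defensive.

(** * Sums over multi-indices *)

Definition madd (a b : seq nat) : seq nat := [seq (x.1 + x.2)%N | x <- zip a b].

Definition msub (a b : seq nat) : seq nat := [seq (x.1 - x.2)%N | x <- zip a b].

(** Up to a factor depending only on the degrees, [mbin (madd b c) b] is the probability that a
    Polya urn starting with one ball of each colour yields the counts [b] first and then [c]. *)
Definition mbin (a b : seq nat) : nat := (\prod_(x <- zip a b) 'C(x.1, x.2))%N.

Lemma size_madd a b : size a = size b -> size (madd a b) = size a.
Proof. by move=> ab; rewrite size_map size_zip ab minnn. Qed.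

Lemma sumn_madd a b : size a = size b -> sumn (madd a b) = (sumn a + sumn b)%N.
Proof.
by elim: a b => [|x a IH] [|y b] //= [ab]; rewrite -/(madd a b) IH // addnACA.
Qed.

Lemma maddC a b : madd a b = madd b a.
Proof.
by elim: a b => [|x a IH] [|y b] //; rewrite /madd /= addnC -/(madd a b) IH.
Qed.

Lemma madd_eq a b c : size a = size b -> size a = size c ->
  (madd b c == a) = all2 leq b a && (c == msub a b).
Proof.
elim: a b c => [|x a IH] [|y b] [|z c] //= [ab] [ac].
rewrite {1}/madd /= eqseq_cons -/(madd b c) IH // eqseq_cons -/(msub a b).
case: (all2 leq b a); rewrite ?andbF ?andbT //=.
case: (c == msub a b); rewrite ?andbF ?andbT //.
apply/eqP/andP => [<-|[yx /eqP ->]]; last by rewrite subnKC.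
by rewrite leq_addr addKn.
Qed.

Lemma mbin_eq0 a b : size a = size b -> ~~ all2 leq b a -> mbin a b = 0%N.
Proof.
rewrite /mbin; elim: a b => [|x a IH] [|y b] //= [ab].
rewrite big_cons negb_and => /orP[|/(IH _ ab) ->]; last by rewrite muln0.
by rewrite -ltnNge => /bin_small ->.
Qed.

Lemma hmonos_uniq n d : uniq (hmonos n d).
Proof.
apply: (@pairwise_uniq (seqlexi nat)) (pairwise_hmonos n d).
by move=> a /=; rewrite ltxx.
Qed.

Lemma madd_hmonos n d e b c : b \in hmonos n d -> c \in hmonos n e ->
  madd b c \in hmonos n (d + e).
Proof.
rewrite !mem_hmonos => /andP[/eqP sb /eqP <-] /andP[/eqP sc /eqP <-].
by rewrite size_madd ?sumn_madd ?sb ?sc // !eqxx.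
Qed.

Lemma big_hmonosS (V : nmodType) n d (F : seq nat -> V) :
  \sum_(a <- hmonos n.+1 d) F a =
  \sum_(i < d.+1) \sum_(a <- hmonos n (d - i)) F (nat_of_ord i :: a).
Proof.
rewrite hmonosS big_flatten big_map (perm_big (iota 0 d.+1)) ?perm_rev //.
rewrite -[iota 0 d.+1]/(index_iota 0 d.+1) big_mkord.
by apply: eq_bigr => i _; rewrite big_map.
Qed.

Lemma sumn_big_hmonosS n d (F : seq nat -> nat) :
  (\sum_(a <- hmonos n.+1 d) F a =
  \sum_(i < d.+1) \sum_(a <- hmonos n (d - i)) F (nat_of_ord i :: a))%N.
Proof. exact: (@big_hmonosS nat). Qed.

(** Pairs are regrouped by their sum. This serves twice: for the urn weights, and for the
    coefficients of a product of two homogeneous polynomials. *)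
Lemma sum_hmonos_pairs (R : pzSemiRingType) n d e (F : seq nat -> seq nat -> R)
    (G : seq nat -> R) :
  \sum_(b <- hmonos n d) \sum_(c <- hmonos n e) F b c * G (madd b c) =
  \sum_(a <- hmonos n (d + e)) (\sum_(b <- hmonos n d)
     \sum_(c <- hmonos n e | madd b c == a) F b c) * G a.
Proof.
under [RHS]eq_bigr do rewrite mulr_suml.
rewrite [RHS]exchange_big /= big_seq [RHS]big_seq; apply: eq_bigr => b bd.
under [RHS]eq_bigr do rewrite mulr_suml big_mkcond.
rewrite [RHS]exchange_big /= big_seq [RHS]big_seq; apply: eq_bigr => c ce.
rewrite (bigD1_seq (madd b c)) ?hmonos_uniq ?madd_hmonos //=.
by rewrite eqxx big1 ?addr0 // => a /negbTE; rewrite eq_sym => ->.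
Qed.

(** Both sides are the coefficient of x^d in the product of the (1 + x)^(a_i), which is (1 +
    x)^|a|. *)
Lemma mbin_Vandermonde n d a : size a = n ->
  (\sum_(b <- hmonos n d) mbin a b = 'C(sumn a, d))%N.
Proof.
elim: n d a => [|n IH] d [|x a] // => [_|[sa]].
  by case: d => [|d]; rewrite /= ?big_nil // big_seq1 /mbin big_nil.
rewrite sumn_big_hmonosS /= -binomial.Vandermonde; apply: eq_bigr => i _.
rewrite -IH // big_distrr /=.  by apply: eq_bigr => b _; rewrite /mbin big_cons.
Qed.

(** The pairs with sum [a] are indexed by the [b] below [a], so Vandermonde's identity applies. The
    value depends on [a] only through its degree: the total counts of the urn are uniform. *)
Lemma sum_mbin_madd n d e a : a \in hmonos n (d + e) ->
  (\sum_(b <- hmonos n d) \sum_(c <- hmonos n e | madd b c == a)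
    mbin (madd b c) b = 'C(d + e, d))%N.
Proof.
rewrite mem_hmonos => /andP[/eqP sa /eqP suma].
rewrite -suma -(mbin_Vandermonde d sa) big_seq [RHS]big_seq.
apply: eq_bigr => b; rewrite mem_hmonos => /andP[/eqP sb /eqP sumb].
(* If [b] is not below [a], no [c] completes it, and [mbin a b] vanishes as well. *)
have [ba|ba] := boolP (all2 leq b a); last first.
  rewrite mbin_eq0 ?sa // big_seq_cond big_pred0 // => c.
  apply/negbTE/negP; rewrite mem_hmonos => /andP[/andP[/eqP sc _]].
  by rewrite madd_eq ?sa ?sb ?sc // (negbTE ba).
have sab : size (msub a b) = n by rewrite size_map size_zip sa sb minnn.
have addK : madd b (msub a b) = a.
  by apply/eqP; rewrite madd_eq ?sa ?sb ?sab // ba eqxx.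
have msubin : msub a b \in hmonos n e.
  rewrite mem_hmonos sab eqxx /=.
  have := @sumn_madd b (msub a b); rewrite addK sb sab suma sumb.
  by move=> /(_ erefl) /addnI <-.
rewrite big_seq_cond (eq_bigl (pred1 (msub a b))); last first.
  move=> c /=; apply/andP/eqP => [[]|->]; last by rewrite addK msubin.
  rewrite mem_hmonos => /andP[/eqP sc _].
  by rewrite madd_eq ?sa ?sb ?sc // => /andP[_ /eqP].
rewrite -big_filter filter_pred1_uniq ?hmonos_uniq // big_seq1.
by rewrite addK.
Qed.

(* The coefficients of (1 - x)^-(a+1) * (1 - x)^-(b+1) = (1 - x)^-(a+b+2). *)
Lemma sum_bin_conv a b e :
  (\sum_(j < e.+1) 'C(a + j, j) * 'C(b + (e - j), e - j) =
   'C(a + b + 1 + e, e))%N.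
Proof.
elim: a e => [|a IHa] e.
  rewrite add0n addn1 -sum_bin (reindex_inj rev_ord_inj) /=.
  apply: eq_bigr => j _; rewrite subSS subKn -1?ltnS // add0n binn mul1n //.
elim: e => [|e IHe]; first by rewrite big_ord1 !bin0.
have -> : (a.+1 + b + 1 + e.+1 = (a + b + 1 + e.+1).+1)%N by lia.
rewrite binS -IHa (_ : (a + b + 1 + e.+1 = a.+1 + b + 1 + e)%N); last by lia.
rewrite -IHe !(big_ord_recl e.+1) /= !bin0 -addnA; congr addn.
rewrite -big_split /=; apply: eq_bigr => j _.
rewrite /bump /= add1n subSS -mulnDl; congr muln.
by rewrite addSn binS addnS addSn.
Qed.

(** This is the coefficient of x^e in the product of the (1 - x)^-(b_i + 1), that is, in (1 -
    x)^-(|b| + n). It involves [b] only through its degree, so the first counts are uniform. *)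
Lemma sum_mbin_maddl n e b : (0 < n)%N -> size b = n ->
  (\sum_(c <- hmonos n e) mbin (madd b c) b =
    'C(sumn b + e + n.-1, e))%N.
Proof.
case: n => // n _; elim: n e b => [|n IH] e [|x b] // [sb].
  case: b sb => // _.
  rewrite sumn_big_hmonosS big_ord_recr big1 ?add0n => [|i _]; last first.
    rewrite (_ : hmonos 0 _ = [::]) ?big_nil //=.
    by case: (e - i)%N (subn_gt0 i e) => //; rewrite ltn_ord.
  rewrite /= subnn big_seq1 /mbin /madd /= big_seq1 !addn0 addnC -bin_sub ?leq_addr //.
  by rewrite /= addKn addn0.
rewrite sumn_big_hmonosS /=.
have -> : (x + sumn b + e + n.+1 = x + (sumn b + n) + 1 + e)%N by lia.
rewrite -sum_bin_conv; apply: eq_bigr => i _.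
rewrite [(sumn b + n + _)%N]addnAC -IH //= big_distrr; apply: eq_bigr => c _.
rewrite /mbin /madd /= big_cons /=; congr muln.
by rewrite -bin_sub ?leq_addr // addKn.
Qed.

Lemma mbin_sym b c : size b = size c ->
  mbin (madd b c) b = mbin (madd c b) c.
Proof.
rewrite /mbin /madd; elim: b c => [|x b IH] [|y c] // [bc].
rewrite /= !big_cons IH // /=; congr muln.
by rewrite -bin_sub ?leq_addr // addKn addnC.
Qed.

(** * Averages of subadditive functions *)

Section PolyaAverages.
Variables (R : realType) (n : nat) (f : seq nat -> R).
Hypothesis n_gt0 : (0 < n)%N.
Hypothesis f_subadd : forall a b, size a = n -> size b = n ->
  f (madd a b) <= f a + f b.

Let size_hm d : size (hmonos n d) = hdim n d.
Proof. exact: size_hmonos. Qed.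

Lemma hdim_gt0 d : (0 < hdim n d)%N.
Proof. by rewrite bin_gt0 leq_addl. Qed.

Lemma sum_mbin_pairs d e (g : seq nat -> R) :
  \sum_(b <- hmonos n d) \sum_(c <- hmonos n e)
    (mbin (madd b c) b)%:R * g (madd b c) =
  'C(d + e, d)%:R * \sum_(a <- hmonos n (d + e)) g a.
Proof.
rewrite (sum_hmonos_pairs _ _ _ (fun b c => (mbin (madd b c) b)%:R)).
rewrite mulr_sumr big_seq [RHS]big_seq; apply: eq_bigr => a ade.
congr (_ * _); rewrite -(sum_mbin_madd ade) natr_sum.
by apply: eq_bigr => b _; rewrite natr_sum.
Qed.

Lemma sum_mbin_left d e (g : seq nat -> R) :
  \sum_(b <- hmonos n d) \sum_(c <- hmonos n e) (mbin (madd b c) b)%:R * g b =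
  'C(d + e + n.-1, e)%:R * \sum_(b <- hmonos n d) g b.
Proof.
rewrite mulr_sumr big_seq [RHS]big_seq; apply: eq_bigr => b.
rewrite mem_hmonos => /andP[/eqP sb /eqP <-].
by rewrite -mulr_suml -natr_sum sum_mbin_maddl.
Qed.

Lemma sum_mbin_right d e (g : seq nat -> R) :
  \sum_(b <- hmonos n d) \sum_(c <- hmonos n e) (mbin (madd b c) b)%:R * g c =
  'C(e + d + n.-1, d)%:R * \sum_(c <- hmonos n e) g c.
Proof.
rewrite exchange_big /= -sum_mbin_left big_seq [RHS]big_seq.
apply: eq_bigr => c; rewrite mem_hmonos => /andP[/eqP sc _].
rewrite big_seq [RHS]big_seq; apply: eq_bigr => b.
rewrite mem_hmonos => /andP[/eqP sb _].
by rewrite mbin_sym // sb sc.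
Qed.

Definition havg d : R := (\sum_(a <- hmonos n d) f a) / (hdim n d)%:R.

Lemma sum_havg d : \sum_(a <- hmonos n d) f a = (hdim n d)%:R * havg d.
Proof. by rewrite mulrC divfK // pnatr_eq0 -lt0n hdim_gt0. Qed.

(* Adding d + e balls to a Polya urn with n colours, the colour counts after
   the first d draws, during the last e draws and in total are uniformly
   distributed on the multi-indices of degree d, e and d + e. *)
Lemma havg_subadd d e : havg (d + e) <= havg d + havg e.
Proof.
have sum1 k : \sum_(a <- hmonos n k) (1 : R) = (hdim n k)%:R.
  by rewrite big_const_seq count_predT size_hm iter_addr_0.
(* [P] is the total weight of all pairs, expressed through the law of the sum; [Pl] and [Pr] express
   it through the two marginals. *)
pose P : R := 'C(d + e, d)%:R * (hdim n (d + e))%:R.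
have P_gt0 : 0 < P by rewrite mulr_gt0 // ltr0n ?hdim_gt0 // bin_gt0 leq_addr.
have Pl : P = 'C(d + e + n.-1, e)%:R * (hdim n d)%:R.
  by rewrite /P -(sum1 (d + e)%N) -sum_mbin_pairs sum_mbin_left sum1.
have Pr : P = 'C(e + d + n.-1, d)%:R * (hdim n e)%:R.
  by rewrite /P -(sum1 (d + e)%N) -sum_mbin_pairs sum_mbin_right sum1.
rewrite -(ler_pM2l P_gt0) mulrDr.
rewrite {1}/P -mulrA -sum_havg {1}Pl -mulrA -sum_havg Pr -mulrA -sum_havg.
rewrite -sum_mbin_left -sum_mbin_right -sum_mbin_pairs -big_split /=.
rewrite big_seq [leRHS]big_seq ler_sum // => b.
rewrite mem_hmonos => /andP[/eqP sb _].
rewrite -big_split /= big_seq [leRHS]big_seq ler_sum // => c.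
rewrite mem_hmonos => /andP[/eqP sc _].
by rewrite -mulrDr ler_wpM2l // f_subadd.
Qed.

(** Degree 0 needs its own lower bound, since bounds on the ratio of [havg] to the degree say
    nothing there. *)
Lemma havg0_ge0 : 0 <= havg 0.
Proof. by have := havg_subadd 0 0; rewrite addn0 lerDl. Qed.

End PolyaAverages.

(** * Fekete's lemma for subadditive sequences *)

Section FeketeLimit.
Variables (R : realType) (A : nat -> R).
Hypothesis A_subadd : forall d e, A (d + e)%N <= A d + A e.

Lemma subadd_eventually_le m (eps : R) : (0 < m)%N -> 0 < eps ->
  \forall d \near \oo, A d <= d%:R * (A m / m%:R + eps).
Proof.
move=> m_gt0 eps_gt0.
have Aqr q r : A (q * m + r)%N <= q%:R * A m + A r.
  elim: q => [|q IH]; first by rewrite mul0n add0n mul0r add0r.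
  rewrite mulSn -addnA (le_trans (A_subadd _ _)) // -natr1 mulrDl mul1r.
  by rewrite [_ * _ + A m]addrC -addrA lerD2l.
(* With d = q m + r, [B] covers [A r] for every remainder r, plus the error [r / m * A m] made in
   replacing q by d / m. *)
pose B := \sum_(r < m) `|A r| + `|A m|.
have B_ge0 : 0 <= B by rewrite addr_ge0 ?sumr_ge0.
near=> d.
have Bd : B <= d%:R * eps.
  rewrite -ler_pdivrMr //; near: d; exact: nbhs_infty_ger.
have m0 : m%:R != 0 :> R by rewrite pnatr_eq0 -lt0n.
rewrite {1}(divn_eq d m) (le_trans (Aqr _ _)) //.
have rm : (d %% m < m)%N by rewrite ltn_mod.
have Ar : A (d %% m)%N <= \sum_(r < m) `|A r|.
  rewrite (bigD1 (Ordinal rm)) //= (le_trans (ler_norm _)) // lerDl.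
  by rewrite sumr_ge0.
have -> : d%:R * (A m / m%:R + eps) =
    (d %/ m)%:R * A m + ((d %% m)%:R / m%:R) * A m + d%:R * eps.
  have dE : d%:R = (d %/ m)%:R * m%:R + (d %% m)%:R :> R.
    by rewrite -natrM -natrD -divn_eq.
  by rewrite dE; field.
rewrite -addrA lerD2l (le_trans Ar) // -lerBlDl (le_trans _ Bd) //.
rewrite /B lerD2l (le_trans (ler_norm _)) // normrN normrM ler_piMl //.
rewrite ger0_norm ?divr_ge0 // ler_pdivrMr ?ltr0n // mul1r ler_nat.
exact: ltnW.
Unshelve. all: by end_near. Qed.

(** The ratios [A m / m] may be unbounded below; in exponential form this case simply has limit 0.
    The sequence [p] is general so as to cover both kinds of Vandermonde suprema. *)
Lemma cvg_expR_inf (p : nat -> R) :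
  (forall m (eps : R), (0 < m)%N -> 0 < eps ->
    \forall d \near \oo, p d <= A m / m%:R + eps) ->
  (\forall d \near \oo, forall a,
    (forall m, (0 < m)%N -> a <= A m / m%:R) -> a <= p d) ->
  expR (p d) @[d --> \oo] -->
    inf [set expR (A m / m%:R) | m in [set m | (0 < m)%N]].
Proof.
move=> p_le p_ge; set S := [set _ | _ in _]; set l := inf S.
have lbS : lbound S 0 by move=> _ [m _ <-]; apply: expR_ge0.
have S0 : S !=set0 by exists (expR (A 1 / 1%:R)), 1%N.
have hlS : has_lbound S by exists 0.
have l_ge0 : 0 <= l by apply: lb_le_inf.
apply/cvgrPdist_le => eps eps_gt0.
have [_ [m m_gt0 <-] um] : exists2 x, S x & x < l + eps.
  by apply: inf_adherent.
have le_gt0 : 0 < l + eps by rewrite ltr_wpDl.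
have d_gt0 : 0 < ln (l + eps) - A m / m%:R.
  by rewrite subr_gt0 -ltr_expR lnK.
near=> d.
rewrite ler_distlC; apply/andP; split; last first.
  rewrite -[leRHS]lnK// ler_expR -(subrKC (A m / m%:R) (ln _)).
  by near: d; apply: p_le.
rewrite lerBlDr (@le_trans _ _ (expR (p d))) ?lerDl ?(ltW eps_gt0)//.
near: d; move: p_ge; apply: filterS => d p_ge.
(* For l = 0 the nonnegativity of [expR] is enough; otherwise [ln l] is a lower bound of all the
   ratios. *)
have [l_gt0|l_le0] := ltP 0 l; last by rewrite (le_trans l_le0)// expR_ge0.
rewrite -[leLHS]lnK// ler_expR; apply: p_ge => k k_gt0.
by rewrite -ler_expR lnK//; apply: (ge_inf hlS); exists k.
Unshelve. all: by end_near. Qed.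

End FeketeLimit.

(** * Limits of Vandermonde suprema *)

Lemma mdim_le n d : (mdim n d <= d.+1 ^ n)%N.
Proof.
rewrite /mdim; elim: n d => [|n IH] d; first by rewrite add0n binn.
rewrite -sum_bin expnS -[X in (_ <= X * _)%N]card_ord -sum_nat_const.
apply: leq_sum => k _; apply: leq_trans (IH k) _.
by case: n {IH} => // n; rewrite leq_exp2r //.
Qed.

(** [ldeg n d] is n / (n + 1) times [d * mdim n d], and n / (n + 1) is at least 1/2. *)
Lemma mdim_ldeg n d : (0 < n)%N -> (d * mdim n d <= 2 * ldeg n d)%N.
Proof.
move=> n_gt0; have := mul_bin_left (n + d) n.
rewrite addKn -[in RHS]bin_sub ?leq_addr // addKn -/(mdim n d) => <-.
by rewrite /ldeg mulnA leq_mul2r mul2n -addnn -addn1 leq_add2l n_gt0 orbT.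
Qed.

Lemma fact_le_exp m : (m`! <= m ^ m)%N.
Proof.
elim: m => // m IH; rewrite factS expnS leq_mul2l /=.
by apply: leq_trans IH _; case: m => // m; rewrite leq_exp2r.
Qed.

Section LogGrowth.
Variable R : realType.

Lemma ln_nat_small (n : nat) (eps : R) : 0 < eps ->
  \forall d \near \oo, n%:R * ln (d.+1%:R : R) <= eps * d%:R.
Proof.
move=> eps_gt0; near=> d.
pose y : R := eps * d%:R / n.+1%:R.
have d_gt0 : (0 < d)%N by near: d; exact: nbhs_infty_gt.
have n1 : 0 < n.+1%:R :> R by rewrite ltr0n.
have y_gt0 : 0 < y by rewrite divr_gt0 // mulr_gt0 // ltr0n.
have dy : d.+1%:R <= expR y.
  (* The resulting bound exp y >= (y / 2)^2 is quadratic in d, which beats d + 1. *)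
  have -> : y = y / 2 + y / 2 by rewrite -splitr.
  rewrite expRD; apply: (@le_trans _ _ ((y / 2) ^+ 2)); last first.
    have y2 : 0 <= y / 2 by rewrite divr_ge0 // ltW.
    rewrite expr2 ler_pM //;
    by rewrite (le_trans _ (expR_ge1Dx _)) // lerDr.
  (* The 8 combines the 4 from [(y / 2) ^+ 2] with the 2 from d + 1 <= 2 d. *)
  have dge : 8 * (n.+1%:R / eps) ^+ 2 <= d%:R :> R.
    by near: d; exact: nbhs_infty_ger.
  have -> : (y / 2) ^+ 2 = d%:R * d%:R / (4 * (n.+1%:R / eps) ^+ 2).
    by rewrite /y; field; rewrite ?gt_eqF //= pnatr_eq0.
  have c_gt0 : 0 < (n.+1%:R / eps) ^+ 2 :> R by rewrite exprn_gt0 // divr_gt0.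
  rewrite ler_pdivlMr ?(mulr_gt0 _ c_gt0) //.
  have le2 : d.+1%:R <= 2 * d%:R :> R.
    by rewrite -natrM ler_nat mul2n -addnn -addn1 leq_add2l.
  have d0 : 0 < d%:R :> R by rewrite ltr0n.
  move: c_gt0 dge le2 d0; clear.
  move: (_ ^+ 2) d.+1%:R d%:R => c u v c0 cv uv v0.
  by nra.
have : ln (d.+1%:R : R) <= y.
  by rewrite -ler_expR lnK ?posrE ?ltr0n.
have ln_ge0 : 0 <= ln (d.+1%:R : R) by rewrite ln_ge0 // ler1n.
rewrite /y ler_pdivlMr // mulrC; apply: le_trans.
by rewrite ler_wpM2r // ler_nat.
Unshelve. all: by end_near. Qed.

Lemma ln_fact_le (m : nat) : (0 < m)%N ->
  ln (m`!%:R : R) <= m%:R * ln m%:R.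
Proof.
move=> m_gt0; rewrite mulr_natl -lnXn ?ltr0n // -natrX.
by rewrite ler_ln ?posrE ?ltr0n ?fact_gt0 ?expn_gt0 ?m_gt0 // ler_nat fact_le_exp.
Qed.

(** From ln m! <= m ln m and m <= (d + 1)^n. It makes the factor m! of the determinant bounds
    disappear in the limit. *)
Lemma ln_fact_small (n : nat) (m : nat -> nat) (eps : R) :
  (forall d, 0 < m d <= d.+1 ^ n)%N -> 0 < eps ->
  \forall d \near \oo, ln ((m d)`!%:R : R) <= eps * (d * m d)%:R.
Proof.
move=> m_le eps_gt0; have := ln_nat_small n eps_gt0; apply: filterS => d le_d.
have /andP[m_gt0 md] := m_le d.
rewrite (le_trans (ln_fact_le m_gt0)) // natrM mulrA mulrC ler_wpM2r //.
rewrite (le_trans _ le_d) // mulr_natl -lnXn ?ltr0n // -natrX.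
by rewrite ler_ln ?posrE ?ltr0n ?expn_gt0 // ler_nat.
Qed.

Lemma sum_eventually_le0 (x : nat -> R) d0 d :
  (forall k, (d0 <= k)%N -> x k <= 0) ->
  \sum_(k < d) x k <= \sum_(k < d0) `|x k|.
Proof.
move=> x_le0; pose y k := if (k < d0)%N then `|x k| else 0.
have y_ge0 k : 0 <= y k by rewrite /y; case: ifP.
have xy k : x k <= y k.
  by rewrite /y; case: ltnP => [_|/x_le0 //]; exact: ler_norm.
(* Padding to [d0 + d] terms avoids comparing [d] with [d0]. *)
apply: (@le_trans _ _ (\sum_(k < d0 + d) y k)).
  rewrite addnC big_split_ord /= ler_wpDr ?sumr_ge0 //.
  by apply: ler_sum => k _; apply: xy.
rewrite big_split_ord /= [X in _ + X]big1 ?addr0 => [|k _]; last first.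
  by rewrite /y ltnNge leq_addr.
by apply: ler_sum => k _; rewrite /y ltn_ord.
Qed.

End LogGrowth.

Section VandermondeLimits.
Variables (R : realType) (n : nat) (f : seq nat -> R).
Hypothesis n_gt0 : (0 < n)%N.
Hypothesis f_subadd : forall a b, size a = n -> size b = n ->
  f (madd a b) <= f a + f b.

Definition havg_limit : R :=
  inf [set expR (havg n f m / m%:R) | m in [set m | (0 < m)%N]].

Lemma hdim_le d : (0 < hdim n d <= d.+1 ^ n.-1)%N.
Proof. by rewrite hdim_gt0 // (mdim_le n.-1). Qed.

Lemma mdim_bounds d : (0 < mdim n d <= d.+1 ^ n)%N.
Proof. by rewrite mdim_le bin_gt0 leq_addl. Qed.

Let A := havg n f.
Let A_subadd d e : A (d + e)%N <= A d + A e.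
Proof. exact: havg_subadd. Qed.

Let powR_exp (v x : R) : 0 < v -> v `^ x^-1 = expR (ln v / x).
Proof. by move=> v_gt0; rewrite /powR gt_eqF // mulrC. Qed.

(** Division by [d * hdim n d] turns both bounds into [havg n f d / d], up to a term that
    [ln_fact_small] makes small. *)
Lemma cvg_hmonos (V : nat -> R) : (forall d, 0 < V d) ->
  (forall d, \sum_(a <- hmonos n d) f a <= ln (V d) <=
     ln ((hdim n d)`!%:R : R) + \sum_(a <- hmonos n d) f a) ->
  V d `^ (d * hdim n d)%:R^-1 @[d --> \oo] --> havg_limit.
Proof.
move=> V_gt0 V_bounds.
under eq_fun do rewrite powR_exp //.
have D_gt0 d : (0 < d)%N -> 0 < (d * hdim n d)%:R :> R.
  by move=> d_gt0; rewrite ltr0n muln_gt0 d_gt0 hdim_gt0.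
apply: cvg_expR_inf => // [m eps m_gt0 eps_gt0|].
  near=> d.
  have d_gt0 : (0 < d)%N by near: d; exact: nbhs_infty_gt.
  rewrite ler_pdivrMr ?D_gt0 //.
  have /andP[_ /le_trans] := V_bounds d; apply.
  have lnF : ln ((hdim n d)`!%:R : R) <= eps / 2 * (d * hdim n d)%:R.
    by near: d; apply: (ln_fact_small hdim_le); rewrite divr_gt0.
  have Ad : A d <= d%:R * (A m / m%:R + eps / 2).
    by near: d; apply: subadd_eventually_le => //; rewrite divr_gt0.
  have h_ge0 : 0 <= (hdim n d)%:R :> R by [].
  rewrite sum_havg // -/A (le_trans (lerD lnF (ler_wpM2l h_ge0 Ad))) //.
  rewrite natrM le_eqVlt; apply/orP; left; apply/eqP; field.
  by rewrite pnatr_eq0 -lt0n.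
near=> d => a a_le.
have d_gt0 : (0 < d)%N by near: d; exact: nbhs_infty_gt.
rewrite ler_pdivlMr ?D_gt0 //.
have /andP[/(le_trans _) + _] := V_bounds d; apply.
rewrite sum_havg // -/A natrM mulrA mulrC ler_wpM2l //.
by rewrite -ler_pdivlMr ?ltr0n // a_le.
Unshelve. all: by end_near. Qed.

Let sum_monos d : \sum_(a <- monos n d) f a =
  \sum_(k < d.+1) (hdim n k)%:R * A k.
Proof.
rewrite big_flatten big_map -[iota 0 d.+1]/(index_iota 0 d.+1) big_mkord.
by apply: eq_bigr => k _; rewrite sum_havg.
Qed.

Let ldegR d : (ldeg n d)%:R = \sum_(k < d.+1) (k%:R * (hdim n k)%:R) :> R.
Proof. by rewrite ldegE // natr_sum; apply: eq_bigr => k _; rewrite natrM. Qed.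

(** By [ldegE] the divisor is the sum of the weights [k * hdim n k]; the quotient is essentially the
    mean of the [havg n f k / k] with these weights. *)
Lemma cvg_monos (V : nat -> R) : (forall d, 0 < V d) ->
  (forall d, \sum_(a <- monos n d) f a <= ln (V d) <=
     ln ((mdim n d)`!%:R : R) + \sum_(a <- monos n d) f a) ->
  V d `^ (ldeg n d)%:R^-1 @[d --> \oo] --> havg_limit.
Proof.
move=> V_gt0 V_bounds.
under eq_fun do rewrite powR_exp //.
have D_ge d : d%:R <= 2 * (ldeg n d)%:R :> R.
  rewrite -natrM ler_nat (leq_trans _ (mdim_ldeg d n_gt0)) // leq_pmulr //.
  by have /andP[] := mdim_bounds d.
have D_gt0 d : (0 < d)%N -> 0 < (ldeg n d)%:R :> R.
  move=> d_gt0; have := lt_le_trans (_ : 0 < d%:R) (D_ge d).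
  by rewrite ltr0n pmulr_rgt0 //; apply.
apply: cvg_expR_inf => // [m eps m_gt0 eps_gt0|].
  have e3 : 0 < eps / 3 by rewrite divr_gt0.
  pose a := A m / m%:R + eps / 3.
  have [d0 _ A_le] := subadd_eventually_le A_subadd m_gt0 e3.
  (* [x k] is the excess of degree k over the slope [a]. It is nonpositive from [d0] on, so the sum
     of the excesses is bounded above independently of d. The thirds of [eps] pay for the slope, the
     factorial and this sum. *)
  pose x k := (hdim n k)%:R * A k - k%:R * (hdim n k)%:R * a.
  near=> d.
  have d_gt0 : (0 < d)%N by near: d; exact: nbhs_infty_gt.
  rewrite ler_pdivrMr ?D_gt0 //.
  have /andP[_ /le_trans] := V_bounds d; apply.
  have lnF : ln ((mdim n d)`!%:R : R) <= eps / 3 * (ldeg n d)%:R.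
    apply: (@le_trans _ _ (eps / 6 * (d * mdim n d)%:R)).
      by near: d; apply: (ln_fact_small mdim_bounds); rewrite divr_gt0.
    have : (d * mdim n d)%:R <= 2 * (ldeg n d)%:R :> R.
      by rewrite -natrM ler_nat mdim_ldeg.
    by move: (eps_gt0); nra.
  have sumx : \sum_(k < d.+1) x k <= eps / 3 * (ldeg n d)%:R.
    apply: (le_trans (sum_eventually_le0 d.+1 (d0 := d0) _)).
      move=> k /A_le Ak; rewrite /x subr_le0 mulrAC mulrC ler_wpM2r //.
    (* The 6 is the 3 of [eps / 3] times the 2 of [D_ge]. *)
    have : \sum_(k < d0) `|x k| * 6 / eps <= d%:R.
      by near: d; exact: nbhs_infty_ger.
    rewrite -mulr_suml -mulr_suml ler_pdivrMr // => le_d.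
    by have := ler_wpM2r (ltW eps_gt0) (D_ge d); move: le_d; lra.
  rewrite sum_monos; move: sumx; rewrite sumrB -mulr_suml -ldegR => sumx.
  move: lnF sumx; rewrite /a; move: (A m / m%:R) (ldeg n d)%:R => q l; lra.
near=> d => a a_le.
have d_gt0 : (0 < d)%N by near: d; exact: nbhs_infty_gt.
rewrite ler_pdivlMr ?D_gt0 //.
have /andP[/(le_trans _) + _] := V_bounds d; apply.
rewrite sum_monos ldegR mulr_sumr ler_sum // => k _.
rewrite mulrA mulrC ler_wpM2l //; case: (posnP k) => [->|k_gt0].
  by rewrite mulr0 /A havg0_ge0.
by rewrite -ler_pdivlMr ?ltr0n // a_le.
Unshelve. all: by end_near. Qed.

End VandermondeLimits.

(** * Vandermonde determinants and Chebyshev constants *)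

Section ComplexModulus.
Variable R : realType.
Implicit Types z : R[i].

Lemma cabsE z : (cabs z)%:C%C = `|z|.
Proof. by rewrite /cabs normc_def. Qed.

Lemma cabs_ge0 z : 0 <= cabs z.
Proof. by rewrite -lecR cabsE normr_ge0. Qed.

Lemma cabs_real (r : R) : 0 <= r -> cabs r%:C%C = r.
Proof. by move=> r0; apply: complexI; rewrite cabsE ger0_norm // lecR. Qed.

Lemma cabs0 : cabs (0 : R[i]) = 0.
Proof. exact: (cabs_real (lexx 0)). Qed.

Lemma cabs1 : cabs (1 : R[i]) = 1.
Proof. exact: (cabs_real ler01). Qed.

Lemma cabs_nat k : cabs (k%:R : R[i]) = k%:R.
Proof. by apply: complexI; rewrite cabsE normr_nat rmorph_nat. Qed.

Lemma cabsM z1 z2 : cabs (z1 * z2) = cabs z1 * cabs z2.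
Proof. by apply: complexI; rewrite rmorphM /= !cabsE normrM. Qed.

Lemma cabsX z k : cabs (z ^+ k) = cabs z ^+ k.
Proof. by apply: complexI; rewrite rmorphXn /= !cabsE normrX. Qed.

Lemma cabsD z1 z2 : cabs (z1 + z2) <= cabs z1 + cabs z2.
Proof. by rewrite -lecR rmorphD /= !cabsE ler_normD. Qed.

Lemma cabsV z : cabs z^-1 = (cabs z)^-1.
Proof. by apply: complexI; rewrite fmorphV /= !cabsE normfV. Qed.

Lemma cabs_eq0 z : (cabs z == 0) = (z == 0).
Proof. by rewrite -(inj_eq (@complexI R)) cabsE normr_eq0. Qed.

Lemma cabs_sum (I : Type) (r : seq I) (P : pred I) (F : I -> R[i]) :
  cabs (\sum_(i <- r | P i) F i) <= \sum_(i <- r | P i) cabs (F i).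
Proof.
elim/big_ind2: _ => [|x1 y1 x2 y2 xy1 xy2|//]; first by rewrite cabs0.
by rewrite (le_trans (cabsD _ _)) // lerD.
Qed.

Lemma cabs_prod (I : Type) (r : seq I) (P : pred I) (F : I -> R[i]) :
  cabs (\prod_(i <- r | P i) F i) = \prod_(i <- r | P i) cabs (F i).
Proof. by apply: big_morph; [exact: cabsM|exact: cabs1]. Qed.

(** X^m - 1 splits and is separable, so there are m distinct m-th roots of unity, and one of them is
    primitive. *)
Lemma prim_root_exists m : (0 < m)%N -> exists z, m.-primitive_root z.
Proof.
move=> m_gt0; pose p : {poly R[i]} := 'X^m - 1.
have [r Dp] := closed_field_poly_normal p.
rewrite (monicP _) ?monicXnsubC // scale1r in Dp.
have r1 : all m.-unity_root r by apply/allP => z; rewrite -root_prod_XsubC -Dp.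
have sz_r : (m < (size r).+1)%N.
  by rewrite -(size_prod_XsubC r id) -Dp size_XnsubC.
have [|z] := hasP (has_prim_root m_gt0 r1 _ sz_r); last by exists z.
by rewrite -separable_prod_XsubC -Dp separable_Xn_sub_1 // pnatr_eq0 -lt0n.
Qed.

End ComplexModulus.

(** * Extremal determinants for a sequence of functions *)

Section DeterminantBounds.
Variables (R : realType) (n : nat) (K : set 'rV[R[i]]_n).
Variable g : nat -> 'rV[R[i]]_n -> R[i].

Definition gdet m (zeta : 'I_m -> 'rV[R[i]]_n) : R[i] :=
  \det (\matrix_(i < m, j < m) g i (zeta j)).

Definition gsup m : R := sup_tuples K (fun zeta : 'I_m -> _ => cabs (gdet zeta)).

Definition gcomb (c : nat -> R[i]) i z : R[i] := \sum_(j < i.+1) c j * g j z.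

Lemma cabs_det_le m (A : 'M[R[i]]_m) (s : nat -> R) :
  (forall i j : 'I_m, cabs (A i j) <= s i) ->
  cabs (\det A) <= m`!%:R * \prod_(i < m) s i.
Proof.
move=> As; rewrite (le_trans (cabs_sum _ _ _)) //.
rewrite -card_Sn cardE -sum1_size natr_sum mulr_suml big_enum /=.
apply: ler_sum => u _; rewrite cabsM cabsX.
have -> : cabs (-1 : R[i]) = 1.
  by apply: complexI; rewrite cabsE normrN1.
rewrite expr1n !mul1r cabs_prod.
by apply: ler_prod => i _; rewrite cabs_ge0 As.
Qed.

(* Row operations by a unitriangular matrix replace each g i by a combination
   with leading coefficient 1. *)
Lemma cabs_gdet_le m (s : nat -> R) (zeta : 'I_m -> 'rV[R[i]]_n) :
  (forall i, (i < m)%N -> exists c, c i = 1 /\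
    forall z, K z -> cabs (gcomb c i z) <= s i) ->
  (forall j, K (zeta j)) ->
  cabs (gdet zeta) <= m`!%:R * \prod_(i < m) s i.
Proof.
move=> s_bound Kzeta.
have /choice[c cP] : forall i : 'I_m, exists c : nat -> R[i], c i = 1 /\
    forall z, K z -> cabs (gcomb c i z) <= s i by move=> i; apply: s_bound.
pose L := \matrix_(i < m, j < m) (if (j <= i)%N then c i j else 0).
have detL : \det L = 1.
  rewrite det_trig; last by apply/is_trig_mxP => i j ij; rewrite mxE leqNgt ij.
  by rewrite big1 // => i _; rewrite mxE leqnn (cP i).1.
rewrite /gdet -[\det _]mul1r -detL -det_mulmx; apply: cabs_det_le => i j.
suff -> : (L *m \matrix_(i < m, j < m) g i (zeta j)) i j =
    gcomb (c i) i (zeta j) by apply: (cP i).2.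
rewrite mxE /gcomb (big_ord_widen m (fun k => c i k * g k (zeta j))) //.
rewrite [RHS]big_mkcond; apply: eq_bigr => k _.
by rewrite !mxE ltnS; case: ifP; rewrite ?mul0r.
Qed.

Hypothesis gdet_bounded : forall m,
  has_ubound [set cabs (gdet zeta) | zeta in
    [set zeta : 'I_m -> 'rV[R[i]]_n | forall j, K (zeta j)]].

Lemma cabs_gdet_le_gsup m (zeta : 'I_m -> 'rV[R[i]]_n) :
  (forall j, K (zeta j)) -> cabs (gdet zeta) <= gsup m.
Proof. by move=> Kzeta; apply: ub_le_sup => //; exists zeta. Qed.

Lemma gsup_ge0 m : 0 <= gsup m.
Proof.
rewrite /gsup /sup_tuples; set S := image _ _.
have [->|/set0P[_ [zeta Kzeta _]]] := eqVneq S set0; first by rewrite sup0.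
by apply: le_trans (cabs_gdet_le_gsup Kzeta); apply: cabs_ge0.
Qed.

(* Laplace expansion along the column of an additional point z: the minor of g m
   is the determinant of the first m points. *)
Lemma gdet_extend m (zeta : 'I_m -> 'rV[R[i]]_n) : gdet zeta != 0 ->
  (forall j, K (zeta j)) -> exists c, c m = 1 /\
    forall z, K z -> cabs (gcomb c m z) <= gsup m.+1 / cabs (gdet zeta).
Proof.
move=> D0 Kzeta.
pose ext z (i : 'I_m.+1) := if unlift ord_max i is Some j then zeta j else z.
pose N := \matrix_(i < m.+1, j < m) g i (zeta j).
pose cof (i : 'I_m.+1) := (-1) ^+ (i + m) * \det (row' i N).
have extE z : gdet (ext z) = \sum_(i < m.+1) cof i * g i z.
  rewrite /gdet (expand_det_col _ ord_max); apply: eq_bigr => i _.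
  rewrite mxE /ext unlift_none mulrC; congr (_ * _ * _); congr (\det _).
  by apply/matrixP => k l; rewrite !mxE liftK.
have cofm : cof ord_max = gdet zeta.
  rewrite /cof addnn -signr_odd odd_double mul1r; congr (\det _).
  by apply/matrixP => k l; rewrite !mxE lift_max.
exists (fun i => cof (inord i) / gdet zeta); split.
  rewrite (_ : inord m = ord_max) ?cofm ?divff //.
  by apply: val_inj; rewrite /= inordK.
move=> z Kz.
have -> : gcomb (fun i => cof (inord i) / gdet zeta) m z = gdet (ext z) / gdet zeta.
  rewrite extE mulr_suml; apply: eq_bigr => i _.
  by rewrite inord_val mulrAC.
rewrite cabsM cabsV ler_wpM2r ?invr_ge0 ?cabs_ge0 //.
by apply: cabs_gdet_le_gsup => j; rewrite /ext; case: unlift.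
Qed.

(** For each tuple with nonzero determinant, [gdet_extend] gives
    [y m <= gsup m.+1 / cabs (gdet zeta)]. The supremum over these tuples yields
    [gsup m * y m <= gsup m.+1], and induction multiplies these inequalities. *)
Lemma prod_le_gsup m (y : nat -> R) : (forall i, 0 <= y i) ->
  (forall i c s, (i < m)%N -> c i = 1 -> 0 <= s ->
    (forall z, K z -> cabs (gcomb c i z) <= s) -> y i <= s) ->
  \prod_(i < m) y i <= gsup m.
Proof.
move=> y_ge0; elim: m => [|m IH] y_le.
  rewrite big_ord0.
  (* The empty tuple always qualifies, even for empty [K], and its determinant is 1. *)
  have zeta (j : 'I_0) : 'rV[R[i]]_n by case: j.
  have <- : cabs (gdet zeta) = 1 by rewrite /gdet det_mx00 cabs1.
  by apply: cabs_gdet_le_gsup => -[].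
rewrite big_ord_recr /=.
have [->|ym0] := eqVneq (y m) 0; first by rewrite mulr0 gsup_ge0.
have ym_gt0 : 0 < y m by rewrite lt_neqAle eq_sym ym0 y_ge0.
rewrite -ler_pdivlMr // (le_trans (IH _)) //.
  by move=> i c s im; apply: y_le; apply: ltnW.
have ge0 : 0 <= gsup m.+1 / y m by rewrite divr_ge0 ?gsup_ge0.
rewrite {1}/gsup /sup_tuples; set S := image _ _.
have [->|/set0P[x0 Sx0]] := eqVneq S set0; first by rewrite sup0.
apply: ge_sup; first by exists x0.
move=> _ [zeta Kzeta <-].
have [->|D0] := eqVneq (gdet zeta) 0; first by rewrite cabs0.
have D_gt0 : 0 < cabs (gdet zeta) by rewrite lt_neqAle eq_sym cabs_eq0 D0 cabs_ge0.
have [c [cm cle]] := gdet_extend D0 Kzeta.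
rewrite ler_pdivlMr // mulrC -ler_pdivlMr //.
by apply: y_le cm _ cle => //; rewrite divr_ge0 ?gsup_ge0 ?cabs_ge0.
Qed.

End DeterminantBounds.

(** * Addition of multi-indices and the lexicographic order *)

Section LexOrder.
Implicit Types a b : seqlexi nat.

Lemma madd_lt a1 a2 b1 b2 : size a1 = size a2 -> size b1 = size b2 ->
  size a1 = size b1 -> (a1 < a2)%O -> (b1 <= b2)%O ->
  (madd a1 b1 < madd a2 b2 :> seqlexi nat)%O.
Proof.
elim: a1 a2 b1 b2 => [|x1 a1 IH] [|x2 a2] [|y1 b1] [|y2 b2] //= [sa] [sb] [sab].
rewrite /madd /= !ltxi_cons lexi_cons !leEnat.
have [x12|x21|<-] := ltngtP x1 x2 => //= [_|lt_a].
  case/andP=> y12 _; rewrite leq_add // ?(ltnW x12) //=.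
  by rewrite leqNgt -addSn leq_add.
case/andP=> y12 /implyP le_b; rewrite leq_add2l y12 /= leq_add2l.
by apply/implyP => /le_b; apply: IH.
Qed.

Lemma madd_le a1 a2 b1 b2 : size a1 = size a2 -> size b1 = size b2 ->
  size a1 = size b1 -> (a1 <= a2)%O -> (b1 <= b2)%O ->
  (madd a1 b1 <= madd a2 b2 :> seqlexi nat)%O.
Proof.
move=> sa sb sab; rewrite le_eqVlt => /predU1P[<-|a12 b12]; last first.
  exact/ltW/madd_lt.
rewrite le_eqVlt => /predU1P[<- //|b12].
rewrite maddC [leRHS]maddC; exact/ltW/madd_lt.
Qed.

(** This makes the leading term of a product come from the two leading terms alone. *)
Lemma madd_eq_lex a1 a2 b1 b2 : size a1 = size a2 -> size b1 = size b2 ->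
  size a1 = size b1 -> (a1 <= a2)%O -> (b1 <= b2)%O ->
  madd a1 b1 = madd a2 b2 -> a1 = a2 /\ b1 = b2.
Proof.
move=> sa sb sab; rewrite le_eqVlt => /predU1P[<-|a12 b12 e]; last first.
  by have := madd_lt sa sb sab a12 b12; rewrite e ltxx.
rewrite le_eqVlt => /predU1P[<- //|b12].
rewrite maddC [RHS]maddC => e.
by have := madd_lt sb (erefl (size a1)) (esym sab) b12 (lexx a1); rewrite e ltxx.
Qed.

End LexOrder.

(** * Homogeneous Chebyshev constants *)

Section ChebyshevConstants.
Variables (R : realType) (n : nat) (K : set 'rV[R[i]]_n).
Local Notation C := R[i].

Definition hpoly (L : seq (seq nat)) (c : seq nat -> C) (z : 'rV[C]_n) : C :=
  \sum_(b <- L) c b * monomial b z.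

(* Bounds on K of the polynomials z^a + (homogeneous combination of monomials of
   the same degree that precede z^a in the listing, i.e. lexicographically
   greater ones). *)
Definition cheb_bounds (a : seq nat) : set R :=
  [set s | 0 <= s /\ exists c : seq nat -> C,
    [/\ c a = 1, forall b : seqlexi nat, (b < (a : seqlexi nat))%O -> c b = 0 &
        forall z, K z -> cabs (hpoly (hmonos n (sumn a)) c z) <= s]].

Definition cheb (a : seq nat) : R := inf (cheb_bounds a).

Lemma cheb_lbound a : lbound (cheb_bounds a) 0.
Proof. by move=> s []. Qed.

Lemma cheb_le a s : cheb_bounds a s -> cheb a <= s.
Proof. by apply: ge_inf; exists 0; apply: cheb_lbound. Qed.

Lemma cheb_ge0 a : 0 <= cheb a.
Proof.
have [e|/set0P ne] := eqVneq (cheb_bounds a) set0; first by rewrite /cheb e inf0.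
by apply: lb_le_inf => //; apply: cheb_lbound.
Qed.

Lemma monomial_madd a b (z : 'rV[C]_n) : size a = n -> size b = n ->
  monomial (madd a b) z = monomial a z * monomial b z.
Proof.
move=> sa sb; rewrite -big_split /=; apply: eq_bigr => k _.
rewrite -exprD; congr (_ ^+ _).
by rewrite /madd (nth_map (0, 0)%N) ?size_zip ?sa ?sb ?minnn // nth_zip ?sa ?sb.
Qed.

Lemma monomialZ a (t : C) (z : 'rV[C]_n) : size a = n ->
  monomial a (t *: z) = t ^+ sumn a * monomial a z.
Proof.
move=> sa; rewrite /monomial sumnE (big_nth 0%N) sa big_mkord expr_sum.
by rewrite -big_split /=; apply: eq_bigr => k _; rewrite mxE exprMn.
Qed.

(** The product of a competitor for [a] and one for [b] is a competitor for [madd a b]; its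
    coefficients are convolutions. *)
Lemma cheb_bounds_madd a b s t : size a = n -> size b = n ->
  cheb_bounds a s -> cheb_bounds b t -> cheb_bounds (madd a b) (s * t).
Proof.
move=> sa sb [s0 [c [ca c_lt c_le]]] [t0 [e [eb e_lt e_le]]].
split; first exact: mulr_ge0.
pose A := hmonos n (sumn a); pose B := hmonos n (sumn b).
have szA x : x \in A -> size x = n by rewrite mem_hmonos => /andP[/eqP].
have szB x : x \in B -> size x = n by rewrite mem_hmonos => /andP[/eqP].
have ce_eq0 p q : (p < (a : seqlexi nat))%O || (q < (b : seqlexi nat))%O ->
    c p * e q = 0.
  by case/orP => [/c_lt|/e_lt] ->; rewrite ?mul0r ?mulr0.
exists (fun x => \sum_(p <- A) \sum_(q <- B | madd p q == x) c p * e q); split.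
- have aA : a \in A by rewrite mem_hmonos sa !eqxx.
  have bB : b \in B by rewrite mem_hmonos sb !eqxx.
  (* Any other pair with the same sum has an entry lexicographically below [a] or [b], where the
     coefficient is 0. The leading coefficient is thus [c a * e b]. *)
  have ce0 p q : p \in A -> q \in B -> madd p q = madd a b ->
      (p != a) || (q != b) -> c p * e q = 0.
    move=> /szA sp /szB sq epq ne; apply: ce_eq0; apply: contraT.
    rewrite negb_or -!leNgt => /andP[ap bq].
    have [] := madd_eq_lex _ _ _ ap bq (esym epq); rewrite ?sa ?sb ?sp ?sq //.
    by move=> pa qb; move: ne; rewrite pa qb !eqxx.
  rewrite (bigD1_seq a) ?hmonos_uniq //= [X in X + _]big_mkcond /=.
  rewrite (bigD1_seq b) ?hmonos_uniq //= eqxx ca eb mulr1.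
  rewrite [X in _ + X + _]big1_seq ?addr0 => [|q /andP[qb qB]]; last first.
    by case: eqP => // abq; rewrite -ca ce0 ?qb ?orbT.
  rewrite big1_seq ?addr0 // => p /andP[pa pA].
  by rewrite big1_seq // => q /andP[/eqP epq qB]; rewrite ce0 ?pa.
- move=> x xab; rewrite big1_seq // => p /andP[_ /szA sp].
  rewrite big1_seq // => q /andP[/eqP epq /szB sq].
  apply: ce_eq0; apply: contraTT xab; rewrite negb_or -!leNgt -epq => /andP[ap bq].
  by rewrite madd_le // ?sa ?sb ?sp ?sq.
move=> z Kz; rewrite /hpoly sumn_madd ?sa ?sb //.
rewrite -(sum_hmonos_pairs _ _ _ (fun p q => c p * e q) (fun x => monomial x z)).
rewrite (_ : \sum_(p <- _) _ = hpoly A c z * hpoly B e z).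
  by rewrite cabsM ler_pM ?cabs_ge0 ?c_le ?e_le.
rewrite mulr_suml big_seq [RHS]big_seq; apply: eq_bigr => p /szA sp.
rewrite mulr_sumr big_seq [RHS]big_seq; apply: eq_bigr => q /szB sq.
by rewrite monomial_madd // mulrACA.
Qed.

Lemma le_mul_inf (S : set R) (x a : R) : S !=set0 -> 0 <= a ->
  (forall s, S s -> x <= a * s) -> x <= a * inf S.
Proof.
move=> S0; rewrite le_eqVlt => /predU1P[<- x_le|a_gt0 x_le].
  by have [s /x_le] := S0; rewrite !mul0r.
rewrite mulrC -ler_pdivrMr //; apply: lb_le_inf => // s /x_le.
by rewrite mulrC -ler_pdivrMr.
Qed.

(** The infima are taken one factor at a time, a fixed value of the last factor being absorbed into
    [a]; hence the general [a] in the induction. *)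
Lemma le_mul_prod_inf m (S : nat -> set R) (x a : R) :
  (forall i, S i !=set0) -> (forall i, lbound (S i) 0) -> 0 <= a ->
  (forall s : nat -> R, (forall i, (i < m)%N -> S i (s i)) ->
     x <= a * \prod_(i < m) s i) ->
  x <= a * \prod_(i < m) inf (S i).
Proof.
move=> S0 Sge0; elim: m a => [|m IH] a a_ge0 x_le.
  by have := x_le (fun=> 0); rewrite !big_ord0; apply.
rewrite big_ord_recr /= mulrA; apply: le_mul_inf => //.
  apply: mulr_ge0 => //; apply: prodr_ge0 => i _; exact: lb_le_inf.
move=> t St; rewrite mulrAC; apply: IH; first by rewrite mulr_ge0 // (Sge0 m).
move=> s Ss; pose s' i := if i == m then t else s i.
have -> : a * t * \prod_(i < m) s i = a * \prod_(i < m.+1) s' i.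
  rewrite big_ord_recr /= {2}/s' eqxx -mulrA [t * _]mulrC; congr (_ * (_ * _)).
  by apply: eq_bigr => i _; rewrite /s' ltn_eqF.
apply: x_le => i; rewrite /s' ltnS leq_eqVlt.
by case: eqP => [-> //|_ /=]; apply: Ss.
Qed.

Hypothesis K_bounded : exists2 B : R, 0 <= B &
  forall z, K z -> forall k, cabs (z ord0 k) <= B.
Hypothesis K_circled : forall (t : C) z, cabs t = 1 -> K z -> K (t *: z).

Lemma cheb_bounds_nonempty a : size a = n -> cheb_bounds a !=set0.
Proof.
move=> sa; have [B B_ge0 KB] := K_bounded.
exists (\prod_(k < n) B ^+ nth 0%N a k); split.
  by apply: prodr_ge0 => k _; apply: exprn_ge0.
exists (fun b => (b == a)%:R); split; first by rewrite eqxx.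
  by move=> b; rewrite lt_neqAle => /andP[/negbTE + _] => ->.
move=> z Kz; have am : a \in hmonos n (sumn a) by rewrite mem_hmonos sa !eqxx.
rewrite /hpoly (bigD1_seq a) ?hmonos_uniq //= eqxx mul1r big1 ?addr0; last first.
  by move=> b /negbTE ->; rewrite mul0r.
rewrite cabs_prod; apply: ler_prod => k _; rewrite cabs_ge0 cabsX.
by rewrite lerXn2r ?nnegrE ?cabs_ge0 // KB.
Qed.

(** As [K] is bounded, both infima on the right run over nonempty sets and are not the default value
    0. *)
Lemma cheb_madd a b : size a = n -> size b = n ->
  cheb (madd a b) <= cheb a * cheb b.
Proof.
move=> sa sb; apply: le_mul_inf; rewrite ?cheb_ge0 //.
  exact: cheb_bounds_nonempty.
move=> t bt; rewrite mulrC; apply: le_mul_inf; first exact: cheb_bounds_nonempty.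
  by case: bt.
by move=> s as_; rewrite mulrC; apply/cheb_le/cheb_bounds_madd.
Qed.

(* Averages over the rotations by the M-th roots of unity, for M larger than all
   the degrees. *)
Lemma hpoly_degree_part (L : seq (seq nat)) c s k :
  all (fun a => size a == n) L -> (forall z, K z -> cabs (hpoly L c z) <= s) ->
  forall z, K z -> cabs (\sum_(b <- L | sumn b == k) c b * monomial b z) <= s.
Proof.
move=> /allP sL c_le z Kz.
pose M := (k + \sum_(b <- L) sumn b).+1.
have ltM b : b \in L -> (sumn b < M)%N.
  by move=> bL; rewrite ltnS (big_rem b) //= addnCA leq_addr.
have kM : (k < M)%N by rewrite ltnS leq_addr.
have [w w_prim] := @prim_root_exists R M isT.
have cabsw : cabs w = 1.
  apply/eqP; rewrite -(@pexpr_eq1 _ _ M) ?cabs_ge0 //.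
  by rewrite -cabsX (prim_expr_order w_prim) cabs1.
have M0 : M%:R != 0 :> C by rewrite pnatr_eq0.
have -> : \sum_(b <- L | sumn b == k) c b * monomial b z =
    M%:R^-1 * \sum_(t < M) (w ^+ (M - k)) ^+ t * hpoly L c (w ^+ t *: z).
  apply: (mulfI M0); rewrite mulVKf // /hpoly.
  under [RHS]eq_bigr do rewrite mulr_sumr.
  rewrite [RHS]exchange_big /= mulr_sumr big_mkcond /= big_seq [RHS]big_seq.
  apply: eq_bigr => b bL.
  have /eqP sb := sL b bL.
  (* The rotation by w^t, weighted by w^(t (M - k)) in place of w^(-t k), multiplies the term of [b]
     by x^t. The powers of [x] sum to M if |b| = k; otherwise x differs from 1, as |b| and k are
     both below M, and they sum to 0. *)
  pose x := w ^+ (M - k + sumn b).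
  have termE (t : 'I_M) :
      (w ^+ (M - k)) ^+ t * (c b * monomial b (w ^+ t *: z)) =
      c b * monomial b z * x ^+ t.
    rewrite monomialZ // -[w ^+ t ^+ _]exprM [(t * _)%N]mulnC exprM.
    rewrite /x exprD exprMn.
    move: (_ ^+ t) (_ ^+ t) (c b) (monomial b z) => *; ring.
  under [RHS]eq_bigr do rewrite termE.
  rewrite -mulr_sumr; have [sbk|sbk] := eqVneq (sumn b) k.
    rewrite /x sbk subnK ?(ltnW kM) // (prim_expr_order w_prim).
    under [in RHS]eq_bigr do rewrite expr1n.
    by rewrite sumr_const card_ord mulrC.
  have x1 : x - 1 != 0.
    rewrite subr_eq0 -(expr0 w) (eq_prim_root_expr w_prim) mod0n.
    have [kb|bk] := leqP k (sumn b).
      rewrite (_ : (M - k + sumn b = M + (sumn b - k))%N); last first.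
        by move: kb kM; clear; lia.
      rewrite modnDl modn_small; last first.
        exact: leq_ltn_trans (leq_subr _ _) (ltM b bL).
      by rewrite subn_eq0 -ltnNge ltn_neqAle eq_sym sbk kb.
    rewrite modn_small; first by move: bk kM; clear; lia.
    by move: bk kM; clear; lia.
  have -> : \sum_(t < M) x ^+ t = 0.
    apply: (mulfI x1); rewrite -subrX1 mulr0 /x exprAC (prim_expr_order w_prim).
    by rewrite expr1n subrr.
  by rewrite !mulr0.
rewrite cabsM cabsV cabs_nat ler_pdivrMl ?ltr0n //.
rewrite (le_trans (cabs_sum _ _ _)) //.
rewrite -[X in X%:R * _]card_ord -sumr_const mulr_suml ler_sum // => t _.
rewrite mul1r cabsM !cabsX cabsw !expr1n mul1r; apply: c_le.
by apply: K_circled; rewrite // cabsX cabsw expr1n.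
Qed.

End ChebyshevConstants.

(** * The order of the listing of monomials *)

Definition mono_lt (a b : seq nat) : bool :=
  (sumn a < sumn b)%N ||
  (sumn a == sumn b) && ((b : seqlexi nat) < (a : seqlexi nat))%O.

Lemma mono_lt_irr a : mono_lt a a = false.
Proof. by rewrite /mono_lt ltnn ltxx andbF. Qed.

Lemma pairwise_mono_lt_hmonos n d : pairwise mono_lt (hmonos n d).
Proof.
have /(sub_in_pairwise (P := mem (hmonos n d))) := pairwise_hmonos n d; apply.
  move=> a b; rewrite !mem_hmonos => /andP[_ /eqP da] /andP[_ /eqP db] ba.
  by rewrite /mono_lt da db eqxx ba orbT.
exact/allP.
Qed.

Lemma pairwise_mono_lt_monos n d : pairwise mono_lt (monos n d).
Proof.
rewrite /monos.
have : pairwise ltn (iota 0 d.+1).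
  by rewrite -sorted_pairwise ?iota_ltn_sorted //; apply: ltn_trans.
elim: (iota _ _) => [//|k s IH] /= /andP[/allP ks /IH s_lt].
rewrite pairwise_cat pairwise_mono_lt_hmonos s_lt !andbT.
apply/allrelP => a b; rewrite mem_hmonos => /andP[_ /eqP da].
move=> /flatten_mapP[j /ks /= kj].
by rewrite mem_hmonos => /andP[_ /eqP db]; rewrite /mono_lt da db (kj : k < j)%N.
Qed.

Lemma mem_monos n d a : (a \in monos n d) = (size a == n) && (sumn a <= d)%N.
Proof.
apply/flatten_mapP/andP => [[k]|[sa ad]].
  by rewrite mem_iota ltnS mem_hmonos => /= kd /andP[-> /eqP ->].
by exists (sumn a); rewrite ?mem_iota ?mem_hmonos ?sa ?eqxx // ltnS.
Qed.

(** * Vandermonde suprema and products of Chebyshev constants *)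

Section VandermondeBounds.
Variables (R : realType) (n : nat) (K : set 'rV[R[i]]_n).
Local Notation C := R[i].
Hypothesis K_bounded : exists2 B : R, 0 <= B &
  forall z, K z -> forall k, cabs (z ord0 k) <= B.
Hypothesis K_circled : forall (t : C) z, cabs t = 1 -> K z -> K (t *: z).

Variable L : seq (seq nat).
Hypothesis L_size : forall a, a \in L -> size a = n.
Hypothesis L_lt : pairwise mono_lt L.
Hypothesis L_full : forall a b,
  a \in L -> size b = n -> sumn b = sumn a -> b \in L.

Let e i := nth [::] L i.
Let g i (z : 'rV[C]_n) := monomial (e i) z.
Let m := size L.

Let L_uniq : uniq L.
Proof. by apply: (pairwise_uniq mono_lt_irr) L_lt. Qed.

Let e_lt i j : (i < j)%N -> (j < m)%N -> mono_lt (e i) (e j).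
Proof. by move=> ij jm; apply: (pairwiseP [::] L_lt) => //; apply: ltn_trans jm. Qed.

Let mem_e i : (i < m)%N -> e i \in L.
Proof. exact: mem_nth. Qed.

Let gdet_bounded k : has_ubound [set cabs (gdet g zeta) | zeta in
    [set zeta : 'I_k -> 'rV[C]_n | forall j, K (zeta j)]].
Proof.
have [B B_ge0 KB] := K_bounded.
pose s i := \prod_(l < n) B ^+ nth 0%N (e i) l.
exists (k`!%:R * \prod_(i < k) s i) => _ [zeta Kzeta <-].
apply: cabs_det_le => i j; rewrite mxE cabs_prod; apply: ler_prod => l _.
by rewrite cabs_ge0 cabsX lerXn2r ?nnegrE ?cabs_ge0 // KB.
Qed.

Let gcomb_hpoly c i z : (i < m)%N -> (forall j, (i < j < m)%N -> c j = 0) ->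
  gcomb g c i z = hpoly L (fun b => c (index b L)) z.
Proof.
move=> im c0; rewrite /gcomb /hpoly (big_nth [::]) big_mkord -/m.
rewrite (big_ord_widen m (fun j => c j * g j z)) // big_mkcond.
apply: eq_bigr => j _; rewrite index_uniq //.
by case: ltnP => // ij; rewrite c0 ?mul0r // ij ltn_ord.
Qed.

Let big_degree k (F : seq nat -> C) : k \in [seq sumn a | a <- L] ->
  \sum_(b <- L | sumn b == k) F b = \sum_(b <- hmonos n k) F b.
Proof.
move=> /mapP[a aL ->]; rewrite -big_filter; apply: perm_big; apply: uniq_perm.
- exact: filter_uniq.
- exact: hmonos_uniq.
move=> b; rewrite mem_filter mem_hmonos andbC.
apply/andP/andP => [[bL /eqP ->]|[/eqP sb /eqP db]]; first by rewrite L_size ?eqxx.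
by rewrite db eqxx (L_full aL).
Qed.

(** The combination may contain monomials of other degrees than [e i]. As [K] is circled, its part
    of degree [sumn (e i)] keeps the bound [s] and is a competitor for [cheb]. *)
Lemma cheb_le_gcomb i c s : (i < m)%N -> c i = 1 -> 0 <= s ->
  (forall z, K z -> cabs (gcomb g c i z) <= s) -> cheb K (e i) <= s.
Proof.
move=> im ci s_ge0 c_le; apply: cheb_le; split=> //.
(* [c1] drops the indices above i, which [gcomb] never reads; [c2] keeps only the degree of
   [e i]. *)
pose c1 j := if (j <= i)%N then c j else 0.
pose c2 b := if (b \in L) && (sumn b == sumn (e i)) then c1 (index b L) else 0.
have c1_le z : K z -> cabs (hpoly L (fun b => c1 (index b L)) z) <= s.
  move=> Kz; rewrite -(gcomb_hpoly z im) => [|j /andP[ij _]]; last first.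
    by rewrite /c1 leqNgt ij.
  rewrite (_ : gcomb _ _ _ _ = gcomb g c i z) ?c_le //.
  by apply: eq_bigr => j _; rewrite /c1 -ltnS ltn_ord.
exists c2; split.
- by rewrite /c2 mem_e // eqxx index_uniq // /c1 leqnn.
- move=> b b_lt; rewrite /c2; case: ifP => // /andP[bL /eqP db].
  have eb : e (index b L) = b by apply: nth_index.
  rewrite /c1; case: ltngtP => // [ji|ji]; last first.
    by move: b_lt; rewrite -eb ji ltxx.
  have := e_lt ji im; rewrite eb /mono_lt db ltnn eqxx /= => /(lt_trans b_lt).
  by rewrite ltxx.
move=> z Kz; rewrite /hpoly -big_degree ?map_f ?mem_e //.
have L_sizeb : all (fun a => size a == n) L.
  by apply/allP => a /L_size ->.
apply: le_trans (hpoly_degree_part K_circled (sumn (e i)) L_sizeb c1_le Kz).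
rewrite big_seq_cond [in leRHS]big_seq_cond le_eqVlt; apply/orP; left.
by apply/eqP; congr cabs; apply: eq_bigr => b; rewrite /c2 => ->.
Qed.

Lemma cheb_bounds_gcomb i s : (i < m)%N -> cheb_bounds K (e i) s ->
  exists c, c i = 1 /\ forall z, K z -> cabs (gcomb g c i z) <= s.
Proof.
move=> im [s_ge0 [c [ci c_lt c_le]]].
pose c1 j := if sumn (e j) == sumn (e i) then c (e j) else 0.
exists c1; split; first by rewrite /c1 eqxx.
move=> z Kz; rewrite gcomb_hpoly // => [|j /andP[ij jm]]; last first.
  rewrite /c1; case: eqP => // dj; apply: c_lt.
  by have := e_lt ij jm; rewrite /mono_lt dj ltnn eqxx.
apply: le_trans (c_le z Kz).
rewrite /hpoly -big_degree ?map_f ?mem_e // [in leRHS]big_mkcond /=.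
rewrite big_seq [in leRHS]big_seq le_eqVlt; apply/orP; left.
apply/eqP; congr cabs; apply: eq_bigr => b bL; rewrite /c1 /e nth_index //.
by case: ifP => //; rewrite mul0r.
Qed.

(** By [L_full] the list consists of whole degrees, which covers both [hmonos n d] and [monos n d].
    The lower bound is [prod_le_gsup]; the upper one is [cabs_gdet_le] for arbitrary competitors,
    followed by passage to the infima. *)
Lemma gsup_bounds : \prod_(a <- L) cheb K a <= gsup K g m <=
  m`!%:R * \prod_(a <- L) cheb K a.
Proof.
have cheb_ge0' a : 0 <= cheb K a by apply: cheb_ge0.
rewrite (big_nth [::]) big_mkord -/m; apply/andP; split.
  apply: (prod_le_gsup gdet_bounded (y := fun i => cheb K (e i))) => // i c s.
  exact: cheb_le_gcomb.
rewrite {1}/gsup /sup_tuples; set S := image _ _.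
have [->|/set0P S0] := eqVneq S set0; first by rewrite sup0 mulr_ge0 ?prodr_ge0.
apply: ge_sup => // _ [zeta Kzeta <-].
(* The value [[set 1]] beyond m only serves to have nonempty sets of nonnegative numbers at all
   indices. *)
pose S' i := if (i < m)%N then cheb_bounds K (e i) else [set 1].
rewrite (eq_bigr (fun i : 'I_m => inf (S' i))) => [|i _]; last first.
  by rewrite /S' ltn_ord.
apply: le_mul_prod_inf => [i|i||s Ss] //.
- rewrite /S'; case: ifP => [im|_]; last by exists 1.
  exact/cheb_bounds_nonempty/L_size/mem_e.
- rewrite /S'; case: ifP => [im|_ _ ->//]; exact: cheb_lbound.
apply: (cabs_gdet_le (K := K)) => // i im.
by apply: cheb_bounds_gcomb => //; have := Ss i im; rewrite /S' im.
Qed.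

End VandermondeBounds.

Lemma ln_prod (R : realType) (I : eqType) (r : seq I) (F : I -> R) :
  (forall i, i \in r -> 0 < F i) ->
  ln (\prod_(i <- r) F i) = \sum_(i <- r) ln (F i).
Proof.
elim: r => [|i r IH] F_gt0; first by rewrite !big_nil ln1.
have r_gt0 j : j \in r -> 0 < F j by move=> jr; rewrite F_gt0 // in_cons jr orbT.
rewrite !big_cons lnM ?IH // posrE ?F_gt0 ?mem_head //.
by rewrite big_seq prodr_gt0.
Qed.

(** The formula exp (p ln u) gives continuity at l > 0; at l = 0, [u d] is eventually below
    eps^(1/p) instead. *)
Lemma cvg_powR (R : realType) (u : nat -> R) (l p : R) : 0 < p ->
  (forall d, 0 <= u d) -> u d @[d --> \oo] --> l ->
  u d `^ p @[d --> \oo] --> l `^ p.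
Proof.
move=> p_gt0 u_ge0 u_l.
have l_ge0 : 0 <= l.
  rewrite -(cvg_lim _ u_l) //; apply: limr_ge; first by apply/cvg_ex; exists l.
  by near=> d.
have [l_gt0|l_le0] := ltP 0 l.
  have u_gt0 : \forall d \near \oo, 0 < u d.
    exact: (cvgr_gt _ u_l).
  rewrite {2}/powR gt_eqF //.
  have : expR (p * ln (u d)) @[d --> \oo] --> expR (p * ln l).
    apply: continuous_cvg; first exact: continuous_expR.
    by apply: cvgMr; apply: continuous_cvg => //; apply: continuous_ln.
  apply: cvg_trans; apply: near_eq_cvg; near=> d.
  by rewrite /powR gt_eqF //; near: d.
have l0 : l = 0 by apply/eqP; rewrite eq_le l_le0 l_ge0.
rewrite l0 powR0 ?gt_eqF //; apply/cvgrPdist_lt => eps eps_gt0.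
have e_gt0 : 0 < eps `^ p^-1 by rewrite powR_gt0.
move/cvgrPdist_lt : u_l => /(_ _ e_gt0); apply: filterS => d.
rewrite l0 !sub0r !normrN !ger0_norm ?powR_ge0 // => lt_d.
have := gt0_ltr_powR p_gt0 (u_ge0 d) (powR_ge0 _ _) lt_d.
by rewrite -powRrM mulVf ?gt_eqF // powRr1 // ltW.
Unshelve. all: by end_near. Qed.

(** * The common limit for a bounded circled set *)

Section CircledLimits.
Variables (R : realType) (n : nat) (K : set 'rV[R[i]]_n).
Hypothesis n_gt0 : (0 < n)%N.
Hypothesis K_bounded : exists2 B : R, 0 <= B &
  forall z, K z -> forall k, cabs (z ord0 k) <= B.
Hypothesis K_circled : forall (t : R[i]) z, cabs t = 1 -> K z -> K (t *: z).

Definition hvdm_sup d : R :=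
  sup_tuples K (fun zeta : 'I_(hdim n d) -> _ => cabs (VDMH zeta)).

Definition vdm_sup d : R :=
  sup_tuples K (fun zeta : 'I_(mdim n d) -> _ => cabs (VDM zeta)).

Lemma hvdm_sup_bounds d :
  \prod_(a <- hmonos n d) cheb K a <= hvdm_sup d <=
  (hdim n d)`!%:R * \prod_(a <- hmonos n d) cheb K a.
Proof.
have := @gsup_bounds R n K K_bounded K_circled (hmonos n d).
rewrite size_hmonos //; apply.
- by move=> a; rewrite mem_hmonos => /andP[/eqP].
- exact: pairwise_mono_lt_hmonos.
by move=> a b; rewrite !mem_hmonos => /andP[_ /eqP <-] -> ->; rewrite !eqxx.
Qed.

Lemma vdm_sup_bounds d :
  \prod_(a <- monos n d) cheb K a <= vdm_sup d <=
  (mdim n d)`!%:R * \prod_(a <- monos n d) cheb K a.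
Proof.
have := @gsup_bounds R n K K_bounded K_circled (monos n d).
rewrite size_monos.
have -> : vdm_sup d =
    gsup K (fun i z => monomial (nth [::] (monos n d) i) z) (mdim n d).
  rewrite /vdm_sup /gsup; congr sup_tuples; apply/funext => zeta.
  congr cabs; congr (\det _); apply/matrixP => i j.
  by rewrite !mxE nth_monos.
apply.
- by move=> a; rewrite mem_monos => /andP[/eqP].
- exact: pairwise_mono_lt_monos.
by move=> a b; rewrite !mem_monos => /andP[_ ad] -> ->; rewrite eqxx.
Qed.

Lemma cvg_circled : exists l : R,
  hvdm_sup d `^ (d * hdim n d)%:R^-1 @[d --> \oo] --> l /\
  vdm_sup d `^ (ldeg n d)%:R^-1 @[d --> \oo] --> l.
Proof.
have cheb_ge0' a : 0 <= cheb K a by apply: cheb_ge0.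
have [cheb_gt0|/existsNP[a /not_implyP[sa cheb_a]]] :=
    pselect (forall a, size a = n -> 0 < cheb K a).
  pose f a := ln (cheb K a).
  have f_subadd a b : size a = n -> size b = n -> f (madd a b) <= f a + f b.
    move=> sa sb; rewrite /f -lnM ?posrE ?cheb_gt0 //.
    rewrite ler_ln ?posrE ?mulr_gt0 ?cheb_gt0 ?size_madd ?sa ?sb //.
    exact: cheb_madd.
  have bounds (L : seq (seq nat)) (m : nat) v :
      (forall a, a \in L -> size a = n) -> (0 < m)%N ->
      \prod_(a <- L) cheb K a <= v <= m%:R * \prod_(a <- L) cheb K a ->
      0 < v /\ \sum_(a <- L) f a <= ln v <= ln (m%:R : R) + \sum_(a <- L) f a.
    move=> L_size m_gt0 /andP[le_v v_le].
    have P_gt0 : 0 < \prod_(a <- L) cheb K a.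
      by rewrite big_seq prodr_gt0 // => a /L_size /cheb_gt0.
    have v_gt0 := lt_le_trans P_gt0 le_v; split=> //.
    rewrite -ln_prod => [|a /L_size /cheb_gt0 //].
    by rewrite -lnM ?posrE ?ltr0n // !ler_ln ?posrE ?mulr_gt0 ?ltr0n // le_v.
  have size_h d a : a \in hmonos n d -> size a = n.
    by rewrite mem_hmonos => /andP[/eqP].
  have size_m d a : a \in monos n d -> size a = n.
    by rewrite mem_monos => /andP[/eqP].
  have Hb d := bounds _ _ _ (@size_h d) (fact_gt0 _) (hvdm_sup_bounds d).
  have Mb d := bounds _ _ _ (@size_m d) (fact_gt0 _) (vdm_sup_bounds d).
  exists (havg_limit n f); split.
    by apply: cvg_hmonos => // d; case: (Hb d).
  by apply: cvg_monos => // d; case: (Mb d).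
have {}cheb_a : cheb K a = 0.
  by apply/eqP; rewrite eq_le cheb_ge0' andbT leNgt; apply/negP.
(* By submultiplicativity the zero at [a] spreads to [madd a c] for every [c], hence to every degree
   from |a| on. *)
have cheb0 d : (sumn a <= d)%N -> exists2 b, b \in hmonos n d & cheb K b = 0.
  move=> ad; have [c cd] : exists c, c \in hmonos n (d - sumn a).
    case: (hmonos n (d - sumn a)) (size_hmonos (d - sumn a) n_gt0) => [|c s _].
      by move=> /esym/eqP; rewrite -leqn0 leqNgt hdim_gt0.
    by exists c; rewrite mem_head.
  exists (madd a c).
    by rewrite -(subnKC ad) madd_hmonos // mem_hmonos sa !eqxx.
  move: cd; rewrite mem_hmonos => /andP[/eqP sc _].
  apply/eqP; rewrite eq_le cheb_ge0' andbT.
  by rewrite (le_trans (cheb_madd K_bounded sa sc)) // cheb_a mul0r.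
have vanish (L : seq (seq nat)) (m : nat) v b : b \in L -> cheb K b = 0 ->
    \prod_(a <- L) cheb K a <= v <= m%:R * \prod_(a <- L) cheb K a -> v = 0.
  move=> bL b0; rewrite (big_rem b) //= b0 mul0r mulr0 => /andP[v0 v_le].
  by apply/eqP; rewrite eq_le v0 v_le.
(* Both sequences vanish for large d. Positive d is required because at d = 0 the exponent is 0 and
   the power is 1. *)
exists 0; split; apply: cvg_near_cst; near=> d.
  have [b bd b0] : exists2 b, b \in hmonos n d & cheb K b = 0.
    by apply: cheb0; near: d; exact: nbhs_infty_ge.
  rewrite (vanish _ _ _ _ bd b0 (hvdm_sup_bounds d)) powR0 //.
  rewrite invr_eq0 pnatr_eq0 -lt0n muln_gt0 hdim_gt0 // andbT.
  by near: d; exact: nbhs_infty_gt.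
have [b bd b0] : exists2 b, b \in hmonos n d & cheb K b = 0.
  by apply: cheb0; near: d; exact: nbhs_infty_ge.
have bm : b \in monos n d.
  by move: bd; rewrite mem_hmonos mem_monos => /andP[-> /eqP ->] /=.
rewrite (vanish _ _ _ _ bm b0 (vdm_sup_bounds d)) powR0 //.
rewrite invr_eq0 pnatr_eq0 -lt0n -(ltn_pmul2l (isT : 0 < 2)%N) muln0.
apply: leq_trans (mdim_ldeg d n_gt0).
rewrite muln_gt0; have /andP[-> _] := mdim_bounds n d; rewrite andbT.
by near: d; exact: nbhs_infty_gt.
Unshelve. all: by end_near. Qed.

End CircledLimits.

(** * The circled set of a weight *)

Lemma rev_iota0 d : rev (iota 0 d.+1) = [seq (d - k)%N | k <- iota 0 d.+1].
Proof.
apply: (@eq_from_nth _ 0%N) => [|i]; first by rewrite size_rev size_map.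
rewrite size_rev size_iota => id.
rewrite nth_rev size_iota // (nth_map 0%N) ?size_iota // !nth_iota //.
by rewrite subSS ltnS leq_subr.
Qed.

(** As t comes first, decreasing powers of t mean increasing degrees in the other variables: setting
    t = 1 preserves the listing order, so no permutation or sign arises. *)
Lemma hmonosS_monos N d :
  hmonos N.+1 d = [seq (d - sumn a)%N :: a | a <- monos N d].
Proof.
rewrite hmonosS rev_iota0 /monos map_flatten -!map_comp; congr flatten.
apply/eq_in_map => k; rewrite mem_iota ltnS => /= kd; rewrite subKn //.
by apply/eq_in_map => a; rewrite mem_hmonos => /andP[_ /eqP ->].
Qed.

Lemma hmono_idx_mono_idx N d i : (0 < N)%N -> (i < mdim N d)%N ->
  hmono_idx N.+1 d i = (d - sumn (mono_idx N i))%N :: mono_idx N i /\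
  (size (mono_idx N i) = N /\ sumn (mono_idx N i) <= d)%N.
Proof.
move=> N_gt0 id; have im : (i < size (monos N d))%N by rewrite size_monos.
rewrite /hmono_idx hmonosS_monos (nth_map [::]) // nth_monos //.
by have := mem_nth [::] im; rewrite mem_monos nth_monos // => /andP[/eqP].
Qed.

(** The two root exponents are in the ratio N / (N + 1), which is where the power (N + 1) / N comes
    from. *)
Lemma ldeg_hdim N d : (ldeg N d * N.+1 = N * (d * hdim N.+1 d))%N.
Proof.
have := mul_bin_left (N + d) N.
rewrite addKn -[in RHS]bin_sub ?leq_addr // addKn => <-.
by rewrite /ldeg mulnC mulnCA.
Qed.

Section CircledSet.
Variables (R : realType) (N : nat).
Hypothesis N_gt0 : (0 < N)%N.
Local Notation C := R[i].
Variables (E : set 'rV[C]_N) (w : 'rV[C]_N -> R).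

Lemma monomial_row_mx x a (t : C) (v : 'rV[C]_N) :
  monomial (x :: a) (row_mx t%:M (t *: v)) = t ^+ x * monomial a (t *: v).
Proof.
rewrite /monomial big_split_ord /= big_ord1 row_mxEl mxE eqxx mulr1n.
by congr (_ * _); apply: eq_bigr => k _; rewrite row_mxEr.
Qed.

(** The entry t^(d - |a|) (t lambda)^a equals t^d lambda^a, so column j is scaled by t_j^d.
    [hdim (1 + N) d] computes to [mdim N d], so both tuples share one index type. *)
Lemma VDMH_row_mx d (t : 'I_(mdim N d) -> C)
    (lambda : 'I_(mdim N d) -> 'rV[C]_N) :
  VDMH (fun j : 'I_(hdim (1 + N) d) => row_mx (t j)%:M (t j *: lambda j)) =
  VDM lambda * \prod_(j < mdim N d) t j ^+ d.
Proof.
have -> : \prod_(j < mdim N d) t j ^+ d =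
    \det (diag_mx (\row_(j < mdim N d) (t j ^+ d))).
  by rewrite det_diag; apply: eq_bigr => j _; rewrite mxE.
rewrite /VDM -det_mulmx mul_mx_diag; congr (\det _); apply/matrixP => i j.
rewrite !mxE.
have [-> [sz le_d]] := hmono_idx_mono_idx N_gt0 (ltn_ord i).
by rewrite monomial_row_mx monomialZ // mulrA -exprD subnK // mulrC.
Qed.

Hypothesis w_ge0 : forall z, E z -> 0 <= w z.

Lemma weighted_sup_hvdm_sup d :
  sup_tuples E (fun lambda : 'I_(mdim N d) -> 'rV[C]_N =>
    cabs (VDM lambda) * \prod_(j < mdim N d) w (lambda j) ^+ d) =
  hvdm_sup (circled_set E w) d.
Proof.
rewrite /hvdm_sup /sup_tuples; congr sup; apply/seteqP; split.
  move=> _ [lambda Elambda <-].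
  pose t j := (w (lambda j))%:C%C.
  exists (fun j => row_mx (t j)%:M (t j *: lambda j)).
    move=> j; exists (t j), (lambda j); split=> //.
    by rewrite cabs_real // w_ge0.
  rewrite VDMH_row_mx cabsM cabs_prod; congr (_ * _).
  by apply: eq_bigr => j _; rewrite cabsX cabs_real // w_ge0.
move=> _ [zeta Fzeta <-].
(* At t = 0 the point does not determine lambda, so a preimage is chosen. *)
have /choice[p pP] : forall j : 'I_(mdim N d), exists p : C * 'rV[C]_N,
    [/\ E p.2, cabs p.1 = w p.2 & zeta j = row_mx p.1%:M (p.1 *: p.2)].
  by move=> j; have [t [lambda h]] := Fzeta j; exists (t, lambda).
exists (fun j => (p j).2); first by move=> j; case: (pP j).
have -> : zeta = (fun j => row_mx (p j).1%:M ((p j).1 *: (p j).2)).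
  by apply/funext => j; case: (pP j).
rewrite VDMH_row_mx cabsM cabs_prod; congr (_ * _).
by apply: eq_bigr => j _; rewrite cabsX; case: (pP j) => _ ->.
Qed.

Lemma circled_set_circled (t : C) z :
  cabs t = 1 -> circled_set E w z -> circled_set E w (t *: z).
Proof.
move=> t1 [s [lambda [El sw ->]]]; exists (t * s), lambda; split=> //.
  by rewrite cabsM t1 mul1r.
by rewrite scale_row_mx scale_scalar_mx scalerA.
Qed.


End CircledSet.

(** * Boundedness of the circled set *)

Section Boundedness.
Variables (R : realType) (N : nat).
Local Notation C := R[i].
Variables (E : set 'rV[C]_N) (w : 'rV[C]_N -> R).

Lemma compact_locally_bounded (f : 'rV[C]_N -> R) : compact E ->
  (forall x, E x -> exists b : R, \forall y \near x, E y -> f y <= b) ->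
  exists2 B : R, 0 <= B & forall z, E z -> f z <= B.
Proof.
move=> /compact_near_coveringP cE f_loc.
(* Naturals serve as candidate bounds: near each point all large i bound [f], and compactness makes
   the threshold uniform. *)
have [|B _ fB] := cE nat \oo (fun i z => E z -> f z <= i%:R) _ _.
  move=> x Ex; have [b fb] := f_loc x Ex.
  exists ([set y | E y -> f y <= b], [set i | b <= i%:R]); first split=> //=.
    exact: nbhs_infty_ger.
  by move=> [y i] /= [yb bi] Ey; apply: le_trans (yb Ey) bi.
by exists B%:R => // z Ez; apply: (fB B) => //=.
Qed.

Lemma compact_usc_bounded : compact E -> usc_on E (EFin \o w) ->
  exists2 B : R, 0 <= B & forall z, E z -> w z <= B.
Proof.
move=> cE w_usc; apply: compact_locally_bounded => [//|x Ex].
exists (w x + 1).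
have lt1 : ((EFin \o w) x < (w x + 1)%:E)%E by rewrite lte_fin ltrDl.
have := w_usc x _ Ex lt1; apply: filterS => y wy.
by apply: ltW; rewrite -lte_fin; exact: wy.
Qed.

Lemma compact_coord_bounded k : compact E ->
  exists2 B : R, 0 <= B & forall z, E z -> cabs (z ord0 k) <= B.
Proof.
move=> cE; apply: compact_locally_bounded => // x Ex.
exists (cabs (x ord0 k) + 1).
have /cvgrPdist_lt/(_ 1 ltr01) := @coord_continuous R[i] 1 N ord0 k x.
apply: filterS => y xy _.
have le1 : cabs (x ord0 k - y ord0 k) <= 1.
  by rewrite -lecR cabsE ltW.
rewrite -(subrKC (x ord0 k) (y ord0 k)) (le_trans (cabsD _ _)) // lerD2l.
rewrite (_ : cabs _ = cabs (x ord0 k - y ord0 k)) //.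
by apply: complexI; rewrite !cabsE distrC.
Qed.

Lemma circled_set_bounded : compact E -> usc_on E (EFin \o w) ->
  exists2 B : R, 0 <= B &
    forall z, circled_set E w z -> forall k, cabs (z ord0 k) <= B.
Proof.
move=> cE w_usc; have [B B_ge0 wB] := compact_usc_bounded cE w_usc.
have /choice[D D_le] : forall k, exists D : R, 0 <= D /\
    forall z, E z -> cabs (z ord0 k) <= D.
  by move=> k; have [D] := compact_coord_bounded k cE; exists D.
have D_ge0 k : 0 <= D k by case: (D_le k).
(* The 1 accounts for the coordinate t, and [D j] for the coordinate t lambda_j. *)
exists (B * (1 + \sum_k D k)).
  by rewrite mulr_ge0 // addr_ge0 // sumr_ge0.
move=> _ [t [lambda [El tw ->]]] k; rewrite -[k]splitK.
case: (fintype.split k) => j /=.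
  rewrite row_mxEl [j]ord1 mxE eqxx mulr1n tw -[leLHS]mulr1.
  by rewrite ler_pM ?wB // -?tw ?cabs_ge0 // lerDl sumr_ge0.
rewrite row_mxEr mxE cabsM tw ler_pM ?wB // -?tw ?cabs_ge0 //.
rewrite (le_trans ((D_le j).2 _ El)) // (bigD1 j) //= addrCA lerDl.
by rewrite addr_ge0 // sumr_ge0.
Qed.

End Boundedness.

Theorem corollary2p1 (R : realType) (N : nat) (E : set 'rV[R[i]]_N)
    (w : 'rV[R[i]]_N -> R) (N_gt0 : (0 < N)%N) (E_compact : compact E)
    (E_nonpluripolar : ~ pluripolar E) (w_admissible : admissible_weight E w) :
  weighted_transfinite_diameter E w =
    homogeneous_transfinite_diameter (circled_set E w) `^ (N.+1%:R / N%:R) /\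
  homogeneous_transfinite_diameter (circled_set E w) `^ (N.+1%:R / N%:R) =
    transfinite_diameter (circled_set E w) `^ (N.+1%:R / N%:R).
Proof.
have [w_ge0 w_usc _] := w_admissible.
have [l [cvg_h cvg_t]] := cvg_circled (ltn0Sn N)
  (circled_set_bounded E_compact w_usc) (@circled_set_circled R N E w).
have h_l : homogeneous_transfinite_diameter (circled_set E w) = l.
  exact: cvg_lim cvg_h.
have t_l : transfinite_diameter (circled_set E w) = l by exact: cvg_lim cvg_t.
have p_gt0 : 0 < N.+1%:R / N%:R :> R by rewrite divr_gt0 ?ltr0n.
rewrite h_l t_l; split=> //.
apply: cvg_lim => //; have := cvg_powR p_gt0 (fun d => powR_ge0 _ _) cvg_h.
apply: cvg_trans; apply: near_eq_cvg; apply: nearW => d /=.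
(* The terms agree for every d, including d = 0, where both exponents are 0 because the inverse of 0
   is 0. *)
rewrite weighted_sup_hvdm_sup // -powRrM; congr (_ `^ _).
have -> : (ldeg N d)%:R = N%:R * (d * hdim N.+1 d)%:R / N.+1%:R :> R.
  by rewrite -natrM -ldeg_hdim natrM mulfK // pnatr_eq0.
by rewrite invf_div invfM mulrC -!mulrA.
Qed.
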